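(* For every integer $r\ge 3$ there is an $n_0$ such that the following holds for all $n\ge n_0$. If $G$ is a graph on $n$ vertices which has some proper edge coloring $\chi$ satisfying $\phi_{\chi}^R(G,K_r)\ge \mathrm{ex}(n,K_r)$, then $G$ is isomorphic to the Turán graph $T_{r-1}(n)$. In particular, $\phi^R(n,K_r)=\mathrm{ex}(n,K_r)$ for all $n\ge n_0$, and the only graph $G$ on $n$ vertices attaining the maximum in the definition of $\phi^R(n,K_r)$ (i.e. with $\max_{\chi}\phi_{\chi}^R(G,K_r)=\phi^R(n,K_r)$) is, up to isomorphism, the Turán graph $T_{r-1}(n)$.
   Context: All graphs are finite and simple. A proper edge coloring of $G$ assigns a color to every edge so that any two edges sharing a vertex receive distinct colors (any number of colors is allowed). A copy of a graph $H$ in $G$ is rainbow (under $\chi$) if all its edges have pairwise distinct colors. For a graph $G$ with a proper edge coloring $\chi$ and a graph $H$, a rainbow $H$-decomposition of $G$ is a partition of $E(G)$ into parts $G_1,\dots,G_t$ such that each $G_i$ is either a single edge or is a rainbow subgraph isomorphic to $H$; $\phi_{\chi}^R(G,H)$ denotes the smallest possible $t$. Equivalently $\phi_\chi^R(G,H)=e(G)-(e(H)-1)N_\chi^R(G,H)$, where $N_\chi^R(G,H)$ is the maximum number of pairwise edge-disjoint rainbow copies of $H$ in $G$ under $\chi$. Define $\phi^R(n,H):=\max_{G}\max_{\chi}\phi_\chi^R(G,H)$, where $G$ ranges over all graphs on $n$ vertices and $\chi$ over all proper edge colorings of $G$. $\mathrm{ex}(n,H)$ is the maximum number of edges in a graph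 on $n$ vertices that does not contain $H$ as a (not necessarily induced) subgraph. $T_{r-1}(n)$ is the complete $(r-1)$-partite graph on $n$ vertices whose part sizes pairwise differ by at most one. *)

(* Defs.v *)
From HB Require Import structures.
From mathcomp Require Import all_boot boolp.

Set Implicit Arguments.
Unset Strict Implicit.
Unset Printing Implicit Defensive.

Section SimpleGraphs.
Variable V : finType.

Record sgraph := SGraph {
  edges : {set {set V}};
  edges_card2 : [forall e in edges, #|e| == 2]
}.

HB.instance Definition _ := [isSub for edges].
HB.instance Definition _ := [Finite of sgraph by <:].

(* [set x; x] is a singleton, so [adj G] is automatically irreflexive. *)
Definition adj (G : sgraph) : rel V := fun x y => [set x; y] \in edges G.

Fact graph_of_rel_subproof (e : rel V) :
  [forall f in [set [set p.1; p.2] | p : V * V & (p.1 != p.2) && e p.1 p.2],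
     #|f : {set V}| == 2].
Proof.
apply/forall_inP => f /imsetP[p]; rewrite inE => /andP[neq _] ->.
by rewrite cards2 neq.
Qed.

Definition graph_of_rel (e : rel V) : sgraph := SGraph (graph_of_rel_subproof e).

Lemma adj_graph_of_rel (e : rel V) :
  symmetric e -> forall x y, adj (graph_of_rel e) x y = (x != y) && e x y.
Proof.
move=> esym x y; rewrite /adj /=; apply/imsetP/idP => [[[a b]]|xy]; last first.
  by exists (x, y); rewrite ?inE.
rewrite inE /= => /andP[ab eab] eq_xy.
have xab : x \in [set a; b] by rewrite -eq_xy set21.
have yab : y \in [set a; b] by rewrite -eq_xy set22.
have axy : a \in [set x; y] by rewrite eq_xy set21.
have bxy : b \in [set x; y] by rewrite eq_xy set22.
move: xab yab axy bxy; rewrite !inE.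
case/orP=> /eqP->; case/orP=> /eqP->; rewrite ?eqxx ?orbT ?orbb ?ab ?eab //=.
- by move=> _ /eqP eba; rewrite eba eqxx in ab.
- by move=> _ _; rewrite eq_sym ab esym eab.
- by move=> /eqP eba; rewrite eba eqxx in ab.
Qed.

End SimpleGraphs.

Definition isomorphic (U V : finType) (G : sgraph U) (H : sgraph V) : Prop :=
  exists2 f : U -> V, bijective f & forall x y, adj H (f x) (f y) = adj G x y.

Definition complete_graph (r : nat) : sgraph 'I_r :=
  graph_of_rel (fun x y : 'I_r => true).

(* The parts are the residue classes modulo [k]; see [turan_balanced]. *)
Definition turan_graph (k n : nat) : sgraph 'I_n :=
  graph_of_rel (fun x y : 'I_n => x %% k != y %% k).

Lemma adj_turan (k n : nat) (x y : 'I_n) :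
  adj (turan_graph k n) x y = (x %% k != y %% k).
Proof.
rewrite adj_graph_of_rel => [|a b]; last by rewrite eq_sym.
by case: eqVneq => [->|//]; rewrite eqxx.
Qed.

Lemma turan_balanced (k n : nat) (i j : 'I_k) :
  #|[set x : 'I_n | x %% k == i]| <= #|[set x : 'I_n | x %% k == j]|.+1.
Proof.
have card_part (a : 'I_k) : #|[set x : 'I_n | x %% k == a]| =
    \sum_(0 <= m < n) (m %% k == a).
  by rewrite big_mkord -sum1_card -big_mkcond; apply: eq_bigl => x; rewrite inE.
rewrite !card_part.
have k_gt0 : 0 < k by apply: leq_ltn_trans (ltn_ord i).
have count (a : 'I_k) :
    \sum_(0 <= m < n) (m %% k == a) = n %/ k + (a < n %% k).
  elim: n {card_part} => [|n IHn]; first by rewrite big_nil div0n mod0n.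
  rewrite big_nat_recr //= IHn divnS // modnS.
  have lt_a := ltn_ord a; have lt_m := ltn_pmod n k_gt0.
  have -> : (k %| n.+1) = (n %% k == k.-1).
    rewrite {1}(divn_eq n k) -addnS dvdn_addr ?dvdn_mull //.
    apply/idP/eqP => [/(dvdn_leq (ltn0Sn _)) le_k|->]; last by rewrite prednK.
    by apply/eqP; rewrite -eqSS prednK // eqn_leq lt_m.
  case: (eqVneq (n %% k) k.-1) => [->|ne] /=; rewrite -addnA.
    rewrite addn0 [RHS]addnC; congr (_ + _); apply/eqP.
    have : a <= k.-1 by rewrite -ltnS prednK.
    by rewrite leq_eqVlt; case: ltngtP.
  by rewrite add0n ltnS; congr (_ + _); case: ltngtP.
rewrite !count -addnS leq_add2l; by case: (_ < _).
Qed.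

Section Copies.
Variables U V : finType.
Implicit Types (H : sgraph U) (G : sgraph V) (B : {set {set V}}).

(* A copy is recorded through its edge set. *)
Definition is_copy H B : bool :=
  [exists f : {ffun U -> V},
     injectiveb f && (B == [set f @: (e : {set U}) | e in edges H])].

Definition contains H G : bool :=
  [exists B : {set {set V}}, (B \subset edges G) && is_copy H B].

(* Only the values of [chi] on [edges G] are relevant; the palette is infinite
   because the number of colors is not restricted. *)
Definition proper_coloring G (chi : {set V} -> nat) : bool :=
  [forall e in edges G, forall f in edges G,
     (e != f) && (e :&: f != set0) ==> (chi e != chi f)].

Definition rainbow (chi : {set V} -> nat) B : bool := dinjectiveb chi (mem B).

Definition rainbow_decomposition (chi : {set V} -> nat) G H
    (P : {set {set {set V}}}) : bool :=
  partition P (edges G) &&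
  [forall B in P, (#|B| == 1) || (is_copy H B && rainbow chi B)].

Definition singletons G : {set {set {set V}}} := [set [set e] | e in edges G].

Lemma singletons_decomposition chi G H :
  rainbow_decomposition chi G H (singletons G).
Proof.
apply/andP; split; last first.
  by apply/forall_inP => B /imsetP[e _ ->]; rewrite cards1.
apply/and3P; split.
- apply/eqP/setP => e; apply/bigcupP/idP => [[B /imsetP[f fG ->]]|eG].
    by rewrite inE => /eqP->.
  by exists [set e]; [apply: imset_f | rewrite inE].
- apply/trivIsetP => A B /imsetP[e _ ->] /imsetP[f _ ->] neq.
  by rewrite disjoints1 inE; apply: contraNneq neq => ->.
- by apply/imsetP => -[e _ /setP/(_ e)]; rewrite !inE eqxx.
Qed.

(* Smallest number of parts; [singletons G] is a valid default by
   [singletons_decomposition]. *)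
Definition phi_col (chi : {set V} -> nat) G H : nat :=
  #|[arg min_(P < singletons G | rainbow_decomposition chi G H P) #|P|]|.

Lemma phi_colP chi G H :
  (exists2 P, rainbow_decomposition chi G H P & #|P| = phi_col chi G H) /\
  (forall P, rainbow_decomposition chi G H P -> phi_col chi G H <= #|P|).
Proof.
rewrite /phi_col; case: arg_minnP => [|P dP minP].
  exact: singletons_decomposition.
by split=> //; exists P.
Qed.

Lemma phi_col_le chi G H : phi_col chi G H <= #|edges G|.
Proof.
apply: leq_trans (leq_imset_card (fun e => [set e]) _).
exact: (phi_colP chi G H).2 (singletons_decomposition chi G H).
Qed.

(* Maximum over all proper colorings; the bound on [m] loses nothing by
   [phi_col_le], see [phi_maxP]. *)
Definition phi_max G H : nat :=
  \max_(m < #|edges G|.+1 |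
        `[< exists2 chi, proper_coloring G chi & phi_col chi G H = m >]) m.

Lemma proper_coloring_exists G : exists chi, proper_coloring G chi.
Proof.
exists pickle; apply/forall_inP => e _; apply/forall_inP => f _.
by apply/implyP => /andP[+ _]; apply: contraNneq => /(pcan_inj pickleK)->.
Qed.

Lemma phi_maxP G H :
  (exists2 chi, proper_coloring G chi & phi_col chi G H = phi_max G H) /\
  (forall chi, proper_coloring G chi -> phi_col chi G H <= phi_max G H).
Proof.
have bnd chi : phi_col chi G H < #|edges G|.+1 by rewrite ltnS phi_col_le.
split=> [|chi pchi].
  have [chi pchi] := proper_coloring_exists G.
  have Pm : `[< exists2 chi, proper_coloring G chi &
                 phi_col chi G H = Ordinal (bnd chi) >].
    by apply/asboolP; exists chi.
  have [] := @eq_bigmax_cond _ [pred m : 'I_(#|edges G|.+1) |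
     `[< exists2 chi, proper_coloring G chi & phi_col chi G H = m >]]
     (@nat_of_ord _).
    by apply/card_gt0P; exists (Ordinal (bnd chi)); apply/asboolP; exists chi.
  by move=> m /asboolP[chi' p' e'] eqm; exists chi'; rewrite // e' -eqm.
rewrite /phi_max (@leq_bigmax_cond _ _ (@nat_of_ord _) (Ordinal (bnd chi))) //.
by apply/asboolP; exists chi.
Qed.

End Copies.

Definition phiR (n : nat) (U : finType) (H : sgraph U) : nat :=
  \max_(G : sgraph 'I_n) phi_max G H.

(* If no graph on [n] vertices is [H]-free, the value is 0. *)
Definition ex_number (n : nat) (U : finType) (H : sgraph U) : nat :=
  \max_(G : sgraph 'I_n | ~~ contains H G) #|edges G|.

(* Main.v *)
(* Let [c = e(K_r) - 1] and let the excess of a graph be the minimum of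
   [e - c * k - ex(n, K_r)] over families of [k] edge-disjoint rainbow [K_r].
   Deleting a vertex [x] of degree [d], together with the edges of [k] rainbow
   [K_r] that pairwise share only [x], raises the excess by
   [delta(T_(r-1)(n)) - d + k * (r - 2)].  A graph with no gaining vertex has
   minimum degree at least [delta(T_(r-1)(n))]; greedy embedding, with colours
   costing only a bounded number of vertices per step (for [r = 3] a maximum
   matching replaces it), then shows that all but boundedly many vertices split
   into [r - 1] independent, almost completely joined parts.  In such a graph all
   edges inside parts can be covered by edge-disjoint rainbow [K_r], one for each,
   so nonnegative excess leaves no such edge and forces the Turán graph.  Hence a
   large graph of nonnegative excess is the Turán graph or loses at most three
   vertices while its excess grows; iterating, the excess would exceed the number
   of edges of the remaining graph. *)

Require Import Defs.
From mathcomp Require Import all_boot perm.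
From mathcomp Require Import zify.

Set Implicit Arguments.
Unset Strict Implicit.
Unset Printing Implicit Defensive.

(** The structure is read off around a single vertex. When no star gains, a vertex [x] of nearly
    minimum degree carries only a bounded maximum star, so a bounded set of vertices meets, outside
    [x], every rainbow [K_r] through [x]. The structural steps all have this shape: a configuration
    avoiding that set would extend to one more clique at [x]. The case [r = 3] is separate because
    the greedy estimate has the factor [p (p - 2) / (p - 1)] with [p = r - 1], which vanishes there.
    In nearly complete graphs a single peeling may then gain nothing, so losses of degree have to be
    accumulated over several peelings. The end game rests on [c >= 2]: an edge inside a part adds
    one to the surplus over the Turán number, a clique using it removes at least two. The obstacle
    is an exceptional vertex with many neighbours in its own part, since the inner edges are then
    too many for a greedy choice that avoids all used vertices. Cliques through exactly one
    exceptional vertex bound these inner degrees beforehand; they are kept edge-disjoint only, and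
    may share vertices. *)

Lemma card_bigcup_le (T I : finType) (D : {set I}) (F : I -> {set T}) k :
  (forall i, i \in D -> #|F i| <= k) -> #|\bigcup_(i in D) F i| <= #|D| * k.
Proof.
move=> Fk; apply: (@leq_trans (\sum_(i in D) #|F i|)).
  elim/big_rec2: _ => [|i m B _ le]; first by rewrite cards0.
  by apply: leq_trans (leq_card_setU _ _) _; rewrite leq_add2l.
by rewrite -sum_nat_const; apply: leq_sum.
Qed.

(** * Rainbow cliques *)

Section Cliques.
Variables (T : finType) (chi : {set T} -> nat).
Implicit Types (E : {set {set T}}) (Q S X : {set T}) (P : {set {set T}}).
Implicit Types (u v w x y z : T).

Definition pairs S : {set {set T}} := [set e : {set T} | e \subset S & #|e| == 2].

Lemma card_pairs S : #|pairs S| = 'C(#|S|, 2).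
Proof. exact: cards_draws. Qed.

Lemma mem_pairs2 S u v :
  ([set u; v] \in pairs S) = [&& u \in S, v \in S & u != v].
Proof. by rewrite inE subUset !sub1set cards2 -andbA; case: (u != v). Qed.

Lemma pairsP S (e : {set T}) :
  reflect (exists u v, [/\ u \in S, v \in S, u != v & e = [set u; v]])
          (e \in pairs S).
Proof.
apply: (iffP idP); last first.
  by case=> u [v [uS vS uv ->]]; rewrite mem_pairs2 uS vS.
rewrite inE => /andP[eS /cards2P[u [v [uv def_e]]]].
by exists u, v; split=> //; apply: (subsetP eS); rewrite def_e !inE eqxx ?orbT.
Qed.

Lemma pairsS S S' : S \subset S' -> pairs S \subset pairs S'.
Proof.
by move=> sub; apply/subsetP=> e; rewrite !inE => /andP[/subset_trans->].
Qed.

Lemma pairsI S S' : pairs S :&: pairs S' = pairs (S :&: S').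
Proof. by apply/setP=> e; rewrite !inE subsetI andbACA andbb. Qed.

Definition nb E v : {set T} := [set w | (v != w) && ([set v; w] \in E)].

Lemma in_nb E v w : (w \in nb E v) = (v != w) && ([set v; w] \in E).
Proof. by rewrite inE. Qed.

Lemma nbC E v w : (w \in nb E v) = (v \in nb E w).
Proof. by rewrite !inE setUC eq_sym. Qed.

Lemma nb_irr E v : v \in nb E v = false.
Proof. by rewrite in_nb eqxx. Qed.

Lemma nbS E E' v : E' \subset E -> nb E' v \subset nb E v.
Proof.
by move=> /subsetP sub; apply/subsetP=> w; rewrite !in_nb => /andP[-> /sub].
Qed.

Definition proper E : Prop := forall u v w,
  [set u; v] \in E -> [set u; w] \in E ->
  chi [set u; v] = chi [set u; w] -> v = w.

Lemma properS E E' : E' \subset E -> proper E -> proper E'.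
Proof. by move=> /subsetP sub pE u v w /sub uv /sub uw; apply: pE. Qed.

Definition rclique E Q : bool := (pairs Q \subset E) && rainbow chi (pairs Q).

Lemma rcliqueS E E' Q : E' \subset E -> rclique E' Q -> rclique E Q.
Proof.
by move=> sub /andP[QE' rQ]; rewrite /rclique rQ (subset_trans QE').
Qed.

Lemma rclique_subset E Q Q' : Q' \subset Q -> rclique E Q -> rclique E Q'.
Proof.
move=> sub /andP[QE /dinjectiveP rQ]; have subp := pairsS sub.
rewrite /rclique (subset_trans subp) //=; apply/dinjectiveP=> e f eQ fQ.
by apply: rQ; apply: (subsetP subp).
Qed.

Lemma rclique1 E x : rclique E [set x].
Proof.
have p0 : pairs [set x] = set0.
  by apply/eqP; rewrite -cards_eq0 card_pairs cards1.
by rewrite /rclique p0 sub0set; apply/dinjectiveP=> e f; rewrite inE.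
Qed.

Lemma rclique_nb E Q u v : rclique E Q -> u \in Q -> v \in Q -> u != v ->
  v \in nb E u.
Proof.
move=> /andP[/subsetP QE _] uQ vQ uv; rewrite in_nb uv; apply: QE.
by rewrite mem_pairs2 uQ vQ.
Qed.

Definition clash E Q : {set T} :=
  \bigcup_(u in Q) \bigcup_(e in pairs Q)
     [set v in nb E u | chi [set u; v] == chi e].

(** For a fixed [u] in [Q] and a fixed edge [e] inside [Q], properness leaves at most one [v]; the
    resulting count is rounded up to a cube. *)
Lemma card_clash E Q k : proper E -> #|Q| <= k -> #|clash E Q| <= k ^ 3.
Proof.
move=> pE Qk.
apply: (@leq_trans (#|Q| * (#|pairs Q| * 1))); last first.
  rewrite muln1 expnS leq_mul // card_pairs.
  apply: (@leq_trans (#|Q| ^ 2)); last by rewrite leq_exp2r.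
  by have := bin2_sum #|Q|; rewrite bin2 -divn2; nia.
apply: card_bigcup_le => u uQ; apply: card_bigcup_le => e eQ.
rewrite leqNgt; apply/card_gt1P => -[v [w [+ + /eqP]]].
rewrite !inE => /andP[/andP[_ uv] /eqP cv] /andP[/andP[_ uw] /eqP cw]; apply.
by apply: (pE u); rewrite // cv cw.
Qed.

(** The new edges all meet in [v], so properness separates their colours from one another; only a
    repetition of a colour inside [Q] could spoil the extension. *)
Lemma rcliqueU1 E Q v : proper E -> rclique E Q -> Q \subset nb E v ->
  v \notin clash E Q -> rclique E (v |: Q).
Proof.
move=> pE rQ Qv nc; have [/subsetP QE /dinjectiveP inj] := andP rQ.
have cases e : e \in pairs (v |: Q) -> e \in pairs Q \/
    exists2 u, u \in Q & e = [set v; u].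
  case/pairsP=> a [b [+ + ab ->]]; rewrite !in_setU1.
  case/orP=> [/eqP eav|aQ]; case/orP=> [/eqP ebv|bQ].
  - by rewrite eav ebv eqxx in ab.
  - by right; exists b; rewrite ?eav.
  - by right; exists a; rewrite // ebv setUC.
  - by left; rewrite mem_pairs2 aQ bQ.
have vE u : u \in Q -> u \in nb E v by move=> uQ; rewrite (subsetP Qv).
have vE2 u : u \in Q -> [set v; u] \in E.
  by move/vE; rewrite in_nb => /andP[].
have ncl u e : u \in Q -> e \in pairs Q -> chi [set v; u] <> chi e.
  move=> uQ eQ ce; case/negP: nc; apply/bigcupP; exists u => //.
  by apply/bigcupP; exists e; rewrite // inE nbC vE //= setUC ce.
apply/andP; split.
  by apply/subsetP=> e /cases[/QE|[u uQ ->]] //; apply: vE2.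
apply/dinjectiveP=> e f /cases[eQ|[a aQ ->]] /cases[fQ|[b bQ ->]] //.
- exact: inj.
- by move=> /esym/ncl; case.
- by move=> /ncl; case.
by move=> ce; congr [set _; _]; apply: (pE v); rewrite ?vE2.
Qed.

(** Greedy choice: once [v] is taken from the head, the later sets are cut down to neighbours of
    [v]. Each loses at most [D] vertices while the size required of it also drops by [D]; the
    reserve [k ^ 3] pays for [clash] at every step. *)
Lemma extend_rclique E D k (Xs : seq {set T}) Q :
  proper E -> rclique E Q -> #|Q| + size Xs <= k ->
  (forall X, X \in Xs -> forall v, v \in X -> Q \subset nb E v) ->
  pairwise (fun X X' : {set T} =>
     [forall v in X, #|X' :\: nb E v| <= D]) Xs ->
  (forall X, X \in Xs -> (size Xs).-1 * D + k ^ 3 < #|X|) ->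
  exists Q', [/\ rclique E Q', Q \subset Q', #|Q'| = #|Q| + size Xs &
     forall v, v \in Q' -> v \in Q \/ exists2 X, X \in Xs & v \in X].
Proof.
move=> pE; have [n sXs] : exists n, size Xs = n by exists (size Xs).
elim: n Xs sXs Q => [|n IH] [|X Xs] //= sXs Q rQ sz XQ.
  by move=> _ _; exists Q; split=> //; [rewrite addn0 | left].
move=> /andP[/allP pwX pw] Xbig.
have [v vX vc] : exists2 v, v \in X & v \notin clash E Q.
  have : 0 < #|X :\: clash E Q|.
    have := Xbig X (mem_head _ _); have Qk : #|Q| <= k by lia.
    have := card_clash pE Qk.
    by have := cardsD X (clash E Q);
       have := subset_leq_card (subsetIr X (clash E Q)); lia.
  by case/card_gt0P=> v; rewrite inE => /andP[]; exists v.
have Qv := XQ X (mem_head _ _) v vX.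
have vQ : v \notin Q by apply/negP=> /(subsetP Qv); rewrite nb_irr.
have cQ : #|v |: Q| = #|Q|.+1 by rewrite cardsU1 vQ.
pose Ys := [seq X' :&: nb E v | X' <- Xs].
have sY : size Ys = size Xs by rewrite size_map.
have YsP Y : Y \in Ys -> exists2 X', X' \in Xs & Y = X' :&: nb E v.
  by case/mapP=> X' X'Xs ->; exists X'.
have [||Y /YsP[X' X'Xs ->] w||Y /YsP[X' X'Xs ->]| Q' [rQ' sub cQ' memQ']] :=
    IH Ys (etrans sY (succn_inj sXs)) (v |: Q).
- exact: rcliqueU1.
- by rewrite cQ sY; lia.
- rewrite inE => /andP[wX' wv]; rewrite subUset sub1set nbC wv.
  by apply: (XQ X') wX'; rewrite inE X'Xs orbT.
- rewrite pairwise_map; apply: sub_pairwise pw => A A' /forall_inP AA'.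
  apply/forall_inP=> w; rewrite inE => /andP[/AA' le _].
  by apply: leq_trans (subset_leq_card _) le; rewrite setSD ?subsetIl.
- have := Xbig X'; rewrite inE X'Xs orbT => /(_ isT).
  have := forall_inP (pwX _ X'Xs) v vX; rewrite sY.
  have := cardsID (nb E v) X'; case: (Xs) X'Xs => //= Z Zs _.
  by rewrite mulSn; lia.
exists Q'; split=> //.
- by apply: subset_trans sub; rewrite subsetUr.
- by rewrite cQ' cQ sY; lia.
move=> w /memQ'[|[Y /YsP[X' X'Xs ->]]]; rewrite !inE.
  by case/orP=> [/eqP->|]; [right; exists X; rewrite ?mem_head | left].
by case/andP=> wX' _; right; exists X'; rewrite ?inE ?X'Xs ?orbT.
Qed.

End Cliques.

Lemma card_bigcup_disjoint (T I : finType) (D : {set I}) (F : I -> {set T}) :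
  {in D &, forall i j, i != j -> [disjoint F i & F j]} ->
  #|\bigcup_(i in D) F i| = \sum_(i in D) #|F i|.
Proof.
move=> dis; rewrite big_mkcond -sum1_card partition_disjoint_bigcup /=.
  rewrite [RHS]big_mkcond; apply: eq_bigr => i _.
  by rewrite sum1_card; case: ifP => // _; rewrite cards0.
move=> i j; case: ifP => [iD|_]; last by rewrite -setI_eq0 set0I.
by case: ifP => [jD|_]; [apply: dis | rewrite -setI_eq0 setI0].
Qed.

(** * Packings and peeling *)

Section Packings.
Variables (T : finType) (chi : {set T} -> nat) (p : nat).
Implicit Types (E : {set {set T}}) (Q S X : {set T}) (P : {set {set T}}).
Implicit Types (u v w x y z : T).

(* Throughout [r = p.+1], so that [p] is the number of parts.  A copy of [K_r] is
   recorded by its vertex set; two copies are edge-disjoint iff they share at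
   most one vertex. *)
Definition packing E P : bool :=
  [forall Q in P, (#|Q| == p.+1) && rclique chi E Q] &&
  [forall Q in P, forall Q' in P, (Q != Q') ==> (#|Q :&: Q'| <= 1)].

Lemma packingP E P :
  reflect ((forall Q, Q \in P -> #|Q| = p.+1 /\ rclique chi E Q) /\
     (forall Q Q' u v, Q \in P -> Q' \in P -> u \in Q -> u \in Q' ->
        v \in Q -> v \in Q' -> u != v -> Q = Q'))
    (packing E P).
Proof.
apply: (iffP andP) => -[PQ dis]; split.
- by move=> Q /(forall_inP PQ)/andP[/eqP].
- move=> Q Q' u v QP Q'P uQ uQ' vQ vQ' uv; apply/eqP/negPn/negP=> neq.
  have := forall_inP (forall_inP dis Q QP) Q' Q'P; rewrite neq leqNgt => /negP.
  by apply; apply/card_gt1P; exists u, v; rewrite !inE uQ uQ' vQ vQ'.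
- by apply/forall_inP=> Q /PQ[-> ->]; rewrite eqxx.
apply/forall_inP=> Q QP; apply/forall_inP=> Q' Q'P; apply/implyP=> neq.
rewrite leqNgt; apply/card_gt1P=> -[u [v [/setIP[uQ uQ'] /setIP[vQ vQ'] uv]]].
by case/eqP: neq; apply: dis uv.
Qed.

Lemma packing0 E : packing E set0.
Proof. by apply/packingP; split=> [Q|Q Q' u v]; rewrite inE. Qed.

Lemma packingU1 E P Q : packing E P -> #|Q| = p.+1 -> rclique chi E Q ->
  (forall Q' u v, Q' \in P -> u \in Q -> u \in Q' -> v \in Q -> v \in Q' ->
     u = v) -> packing E (Q |: P).
Proof.
move=> /packingP[PQ dis] cQ rQ disQ; apply/packingP; split.
  by move=> Q' /setU1P[->|/PQ].
move=> Q1 Q2 u v /setU1P[->|Q1P] /setU1P[->|Q2P] // uQ1 uQ2 vQ1 vQ2 uv.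
- by case/eqP: uv; apply: (disQ Q2).
- by case/eqP: uv; apply: (disQ Q1).
by apply: dis uv.
Qed.

(** A clique on at least two vertices cannot meet itself in at most one, so adding [Q] strictly
    enlarges [P]. *)
Lemma packing_notin P Q : 0 < p -> #|Q| = p.+1 ->
  (forall Q' u v, Q' \in P -> u \in Q -> u \in Q' -> v \in Q -> v \in Q' ->
     u = v) -> Q \notin P.
Proof.
move=> p0 cQ dis; apply/negP=> QP.
have /card_gt1P[u [v [uQ vQ /eqP]]] : 1 < #|Q| by rewrite cQ.
by apply; apply: (dis Q).
Qed.

Definition span P : {set {set T}} := \bigcup_(Q in P) pairs Q.

Lemma spanP P (e : {set T}) :
  reflect (exists2 Q, Q \in P & e \in pairs Q) (e \in span P).
Proof. exact: bigcupP. Qed.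

Lemma span_sub E P : packing E P -> span P \subset E.
Proof.
move=> /packingP[PQ _]; apply/bigcupsP=> Q /PQ[_ /andP[]//].
Qed.

Lemma packing_trivI E P : packing E P -> {in P &, forall Q Q' : {set T},
  Q != Q' -> [disjoint pairs Q & pairs Q']}.
Proof.
move=> /packingP[_ dis] Q Q' QP Q'P neq; rewrite -setI_eq0 pairsI.
rewrite -cards_eq0 card_pairs; apply/eqP/bin_small; rewrite ltnNge.
apply/negP=> /card_gt1P[u [v [/setIP[uQ uQ'] /setIP[vQ vQ'] uv]]].
by case/eqP: neq; apply: dis uv.
Qed.

Lemma card_span E P : packing E P -> #|span P| = #|P| * 'C(p.+1, 2).
Proof.
move=> packP; have [PQ _] := packingP _ _ packP.
rewrite -sum_nat_const card_bigcup_disjoint; last exact: packing_trivI packP.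
by apply: eq_bigr => Q /PQ[cQ _]; rewrite card_pairs cQ.
Qed.

(** Maximal in cardinality and not merely by inclusion: [star_rotate] contradicts it by trading one
    clique for two. *)
Definition maxpacking (pr : pred {set {set T}}) P :=
  pr P /\ forall P', pr P' -> #|P'| <= #|P|.

Lemma maxpacking_exists (pr : pred {set {set T}}) : pr set0 ->
  exists P, maxpacking pr P.
Proof.
move=> pr0; case: (@arg_maxnP _ set0 pr (fun P => #|P|) pr0) => P prP maxP.
by exists P; split.
Qed.
End Packings.

Section Peeling.
Variables (T : finType) (chi : {set T} -> nat) (p : nat).
Hypothesis p1 : 1 < p.
Implicit Types (E : {set {set T}}) (Q S X : {set T}) (P : {set {set T}}).
Implicit Types (u v w x y z : T).

(* With [s] vertices, [part_bound s = ceil (s / p)] is the largest part of the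
   Turán graph and [inner_pairs s] is the number of its non-edges. *)
Definition part_bound s := (s.-1 %/ p).+1.

Definition inner_pairs s := \sum_(i < s) i %/ p.

Lemma inner_pairsS s : inner_pairs s.+1 = inner_pairs s + s %/ p.
Proof. by rewrite /inner_pairs big_ord_recr. Qed.

Lemma part_bound_lower s : 0 < s -> p * part_bound s < s + p.
Proof.
case: s => // s _; rewrite /part_bound /=.
by have := leq_divM s p; rewrite mulnS [p * _]mulnC; lia.
Qed.

Lemma part_bound_upper s : s <= p * part_bound s.
Proof.
case: s => // s; rewrite /part_bound /=.
have p0 : 0 < p by lia.
by have := ltn_ceil s p0; rewrite mulnS mulSn [p * _]mulnC; lia.
Qed.

(* [#|E| - (e(K_r) - 1) * #|P|] is at least the Turán number plus [g], where the
   Turán number is ['C(#|S|, 2) - inner_pairs #|S|]. *)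
Definition excess S E g : Prop := E \subset pairs S /\
  forall P, packing chi p E P ->
    'C(#|S|, 2) + g + ('C(p.+1, 2)).-1 * #|P| <= #|E| + inner_pairs #|S|.

Definition star E x P : bool := packing chi p E P && [forall Q in P, x \in Q].

Lemma star_packingP E x P :
  reflect (packing chi p E P /\ forall Q, Q \in P -> x \in Q) (star E x P).
Proof.
by apply: (iffP andP) => -[packP xP]; split=> //; apply/forall_inP.
Qed.

Lemma star0 E x : star E x set0.
Proof. by apply/star_packingP; split=> [|Q]; rewrite ?packing0 ?inE. Qed.

(** For [v] in [S] this contains [v] itself; in a complete multipartite graph it is the part of
    [v]. *)
Definition nn S E v : {set T} := S :\: nb E v.

Definition peeled E x P : {set {set T}} :=
  E :\: ([set e in E | x \in e] :|: \bigcup_(Q in P) pairs (Q :\ x)).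

Lemma peeled_sub E x P : peeled E x P \subset E.
Proof. exact: subsetDl. Qed.

Lemma card_edges_at S E x : E \subset pairs S ->
  #|[set e in E | x \in e]| = #|nb E x|.
Proof.
move=> /subsetP ES; rewrite -(card_in_imset (f := fun w => [set x; w])).
  apply: eq_card => e; rewrite inE; apply/andP/imsetP=> [[eE]|[w]].
    have /pairsP[u [v [_ _ uv def_e]]] := ES e eE.
    rewrite def_e in eE *; case/set2P=> ->.
      by exists v; rewrite // in_nb uv.
    by exists u; rewrite 1?setUC // in_nb eq_sym uv setUC.
  by rewrite in_nb => /andP[_ eE] ->; rewrite set21.
move=> u v; rewrite !in_nb => /andP[xu _] /andP[xv _] /setP/(_ v).
by rewrite !inE eqxx orbT eq_sym (negPf xv) /= => /eqP.
Qed.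

Lemma nb_subset S E x : E \subset pairs S -> nb E x \subset S.
Proof.
move=> /subsetP ES; apply/subsetP=> w; rewrite in_nb => /andP[_ /ES].
by rewrite mem_pairs2 => /and3P[].
Qed.

Lemma card_nn S E x : E \subset pairs S -> #|nn S E x| + #|nb E x| = #|S|.
Proof.
move=> /(nb_subset x) sub; rewrite -(cardsID (nb E x) S) addnC.
by rewrite (setIidPr sub).
Qed.

Lemma card_peeled S E x P : E \subset pairs S -> star E x P ->
  #|E| = #|peeled E x P| + #|nb E x| + #|P| * 'C(p, 2).
Proof.
move=> ES /star_packingP[packP xP].
have [PQ _] := packingP _ _ _ _ packP.
set A := [set e in E | x \in e]; set B := \bigcup_(Q in P) pairs (Q :\ x).
have sub Q : pairs (Q :\ x) \subset pairs Q by rewrite pairsS ?subsetDl.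
have BE : B \subset E.
  apply/bigcupsP=> Q QP; apply: subset_trans (sub Q) _.
  by have [_ /andP[]] := PQ Q QP.
have AE : A \subset E by apply/subsetP=> e; rewrite inE => /andP[].
have cB : #|B| = #|P| * 'C(p, 2).
  rewrite -sum_nat_const card_bigcup_disjoint => [|Q Q' QP Q'P neq].
    apply: eq_bigr => Q QP; have [cQ _] := PQ Q QP.
    by rewrite card_pairs; have := cardsD1 x Q; rewrite cQ xP // => -[->].
  apply: disjointWl (sub Q) _; apply: disjointWr (sub Q') _.
  exact: packing_trivI packP Q Q' QP Q'P neq.
have dAB : A :&: B = set0.
  apply/setP=> e; rewrite !inE; apply/negP=> /andP[/andP[_ xe]].
  by case/bigcupP=> Q _; rewrite inE => /andP[/subsetP/(_ x xe)]; rewrite !inE eqxx.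
have -> : #|P| * 'C(p, 2) = #|B| by [].
rewrite -(card_edges_at x ES) -/A -addnA.
have := cardsU A B; rewrite dAB cards0 subn0 => <-.
by rewrite -(cardsID (A :|: B) E) (setIidPr _) ?subUset ?AE // addnC.
Qed.

(** All edges of the star cliques disappear, those at [x] and those away from it, so any packing of
    the rest is edge-disjoint from [P]. *)
Lemma packing_peeled E x P P' : star E x P -> packing chi p (peeled E x P) P' ->
  packing chi p E (P :|: P') /\ #|P :|: P'| = #|P| + #|P'|.
Proof.
move=> /star_packingP[packP xP] packP'.
have [PQ dis] := packingP _ _ _ _ packP; have [PQ' dis'] := packingP _ _ _ _ packP'.
have cross Q Q' u v : Q \in P -> Q' \in P' -> u \in Q -> u \in Q' ->
    v \in Q -> v \in Q' -> u = v.
  move=> QP QP' uQ uQ' vQ vQ'; apply/eqP/negPn/negP=> uv.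
  have [_ /andP[/subsetP/(_ [set u; v])]] := PQ' Q' QP'.
  rewrite mem_pairs2 uQ' vQ' uv => /(_ isT); rewrite inE => /andP[/setUP[]].
  have uvE : [set u; v] \in E.
    have [_ /andP[/subsetP/(_ [set u; v])]] := PQ Q QP.
    by rewrite mem_pairs2 uQ vQ uv => /(_ isT).
  case: (eqVneq x u) => [xu|xu]; first by left; rewrite inE uvE xu set21.
  case: (eqVneq x v) => [xv|xv]; first by left; rewrite inE uvE xv set22.
  right; apply/bigcupP; exists Q => //; rewrite mem_pairs2 !inE uQ vQ uv.
  by rewrite eq_sym xu eq_sym xv.
split.
  apply/packingP; split=> [Q /setUP[/PQ//|/PQ'[cQ rQ]]|].
    by split=> //; apply: rcliqueS rQ; apply: peeled_sub.
  move=> Q Q' u v /setUP[QP|QP] /setUP[QP'|QP'] uQ uQ' vQ vQ' uv.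
  - exact: dis uv.
  - by case/eqP: uv; apply: (cross Q Q').
  - by case/eqP: uv; apply: (cross Q' Q).
  - exact: dis' uv.
rewrite cardsU; have -> : P :&: P' = set0; last by rewrite cards0 subn0.
apply/setP=> Q; rewrite !inE; apply/negP=> /andP[QP QP'].
have := @packing_notin _ p P Q; rewrite QP; case/(_ _ _ _)/negP => //.
- by lia.
- by have [] := PQ Q QP.
by move=> Q' u v Q'P uQ uQ' vQ vQ'; apply: (cross Q' Q).
Qed.

(** Each star clique is credited with [('C(p.+1, 2)).-1] but takes only ['C(p, 2)] edges not at [x],
    a net gain of [p - 1]. The last vertex adds [#|S| - part_bound #|S|] to the Turán number,
    whereas [x] takes away [#|S| - #|nn S E x|] edges. *)
Lemma peel S E g g' x P : excess S E g -> x \in S -> star E x P ->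
  g' + part_bound #|S| <= g + #|P| * p.-1 + #|nn S E x| ->
  excess (S :\ x) (peeled E x P) g'.
Proof.
move=> [ES exc] xS starP gain; split.
  apply/subsetP=> e; rewrite !inE negb_or negb_and => /andP[/andP[+ _] eE].
  rewrite eE /= => xe; have := subsetP ES e eE; rewrite inE => /andP[eS ->].
  by rewrite subsetD1 eS xe.
move=> P' packP'; have [packU cU] := packing_peeled starP packP'.
have := exc _ packU; rewrite cU (card_peeled ES starP).
move: gain; have := card_nn x ES.
rewrite (cardsD1 x S) xS add1n inner_pairsS /part_bound /= !binS !bin1.
have -> : ('C(p, 2) + p).-1 = 'C(p, 2) + p.-1 by lia.
by nia.
Qed.

End Peeling.

(** * Maximum stars at a vertex, and the sparse vertex of a stuck graph *)

Section Stars.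
Variables (T : finType) (chi : {set T} -> nat) (p : nat).
Hypothesis p1 : 1 < p.
Implicit Types (E : {set {set T}}) (Q S X : {set T}) (P : {set {set T}}).
Implicit Types (u v w x y z : T).

Lemma starU1 E x P Q : star chi p E x P -> x \in Q -> #|Q| = p.+1 ->
  rclique chi E Q -> (forall v, v \in Q -> v != x -> v \notin cover P) ->
  star chi p E x (Q |: P) /\ Q \notin P.
Proof.
move=> /star_packingP[packP xP] xQ cQ rQ QP.
have dis Q' u v : Q' \in P -> u \in Q -> u \in Q' -> v \in Q -> v \in Q' -> u = v.
  have isx w : Q' \in P -> w \in Q -> w \in Q' -> w = x.
    move=> Q'P wQ wQ'; apply/eqP/negPn/negP=> /(QP _ wQ)/bigcupP; case.
    by exists Q'.
  by move=> Q'P uQ uQ' vQ vQ'; rewrite (isx u) // (isx v).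
split; last by apply: packing_notin cQ dis; lia.
apply/star_packingP; split; first exact: packingU1 dis.
by move=> Q' /setU1P[->|/xP].
Qed.

Lemma maxstar_blocks E x P Q : maxpacking (star chi p E x) P -> x \in Q ->
  #|Q| = p.+1 -> rclique chi E Q ->
  (forall v, v \in Q -> v != x -> v \notin cover P) -> False.
Proof.
move=> [starP maxP] xQ cQ rQ QP; have [starQ QnP] := starU1 starP xQ cQ rQ QP.
by have := maxP _ starQ; rewrite cardsU1 QnP add1n ltnn.
Qed.

Lemma star_cover_nb E x P v : star chi p E x P -> v \in cover P -> v != x ->
  v \in nb E x.
Proof.
move=> /star_packingP[/packingP[PQ _] xP] /bigcupP[Q QP vQ] vx.
by have [_ rQ] := PQ Q QP; apply: rclique_nb rQ _ _ _; rewrite ?xP // eq_sym.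
Qed.

Lemma card_star_cover E x P : star chi p E x P -> #|cover P :\ x| = #|P| * p.
Proof.
move=> /star_packingP[/packingP[PQ dis] xP].
have -> : cover P :\ x = \bigcup_(Q in P) (Q :\ x).
  apply/setP=> v; rewrite in_setD1; apply/andP/bigcupP.
    by case=> vx /bigcupP[Q QP vQ]; exists Q; rewrite // !inE vx.
  by case=> Q QP; rewrite !inE => /andP[-> vQ]; split=> //; apply/bigcupP; exists Q.
rewrite card_bigcup_disjoint -?sum_nat_const.
  apply: eq_bigr => Q QP; have [cQ _] := PQ Q QP.
  by have := cardsD1 x Q; rewrite cQ xP // => -[].
move=> Q Q' QP Q'P neq; rewrite -setI_eq0; apply/eqP/setP=> v; rewrite !inE.
apply/negP=> /andP[/andP[vx vQ] /andP[_ vQ']]; case/eqP: neq.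
by apply: (dis _ _ v x); rewrite ?xP.
Qed.

Lemma card_cover_le E P : packing chi p E P -> #|cover P| <= #|P| * p.+1.
Proof. by move=> /packingP[PQ _]; apply: card_bigcup_le => Q /PQ[->]. Qed.

Lemma rclique2 E u v : proper chi E -> v \in nb E u -> rclique chi E [set u; v].
Proof.
move=> pE uv; apply: rcliqueU1 => //; first exact: rclique1.
  by rewrite sub1set.
have p0 : pairs [set v] = set0.
  by apply/eqP; rewrite -cards_eq0 card_pairs cards1.
by rewrite /clash big_set1 p0 big_set0 inE.
Qed.

(** Any two edges of a triangle share a vertex, so every properly coloured triangle is rainbow. *)
Lemma rclique3 E x u v : proper chi E -> u \in nb E x -> v \in nb E x ->
  v \in nb E u -> rclique chi E (x |: [set u; v]).
Proof.
move=> pE xu xv uv; apply: rcliqueU1 => //; first exact: rclique2.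
  by apply/subsetP=> w /set2P[]->.
have nm w w' : w' \in nb E w -> x \in nb E w -> w' \in nb E x ->
    chi [set w; x] <> chi [set w; w'].
  rewrite !in_nb => /andP[_ ww'] /andP[_ wx] /andP[xw' _] /(pE _ _ _ wx ww').
  by apply/eqP.
apply/bigcupP=> -[w wuv /bigcupP[e euvp]]; have:= euvp.
rewrite [e \in _]inE => /andP[euv /eqP ce].
have {euv ce} def_e : e = [set u; v].
  by apply/eqP; rewrite eqEcard euv ce cards2; case: (u != v).
rewrite inE def_e => /andP[_ /eqP]; case/set2P: wuv => ->.
  by apply: nm; rewrite // nbC.
by rewrite [[set u; v]]setUC; apply: nm; rewrite // nbC.
Qed.

(* Peeling any star would not raise the excess. *)
Definition stuck S E : Prop := [/\ E \subset pairs S, proper chi E &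
  forall x P, x \in S -> star chi p E x P ->
    #|P| * p.-1 + #|nn S E x| <= part_bound p #|S|].

Lemma stuck_nn S E x : stuck S E -> x \in S -> #|nn S E x| <= part_bound p #|S|.
Proof. by move=> [_ _ st] xS; have := st _ _ xS (star0 _ _ _ _); rewrite cards0. Qed.

Lemma maxnn_exists S E : 0 < #|S| ->
  exists2 x, x \in S & forall v, v \in S -> #|nn S E v| <= #|nn S E x|.
Proof.
case/card_gt0P=> x0 x0S.
by case: (arg_maxnP (fun x => #|nn S E x|) x0S) => x xS maxx; exists x.
Qed.

Definition slack := 2 * (p.+1 ^ 3) + 4.

(** Let [x] have minimum degree and put [t = part_bound p #|S| - #|nn S E x|]. A star at [x] has at
    most [t / (p - 1)] cliques, and the neighbours it leaves uncovered exceed the degree demand of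
    the greedy choice by about [p t (p - 2) / (p - 1)]. For [p > 2] this is at least [p t / 2], so
    [t > slack p] also pays for the colours and yields one more star clique. *)
Lemma stuck_sparse_vertex_gt2 S E : 2 < p -> stuck S E -> 0 < #|S| ->
  exists2 x, x \in S & part_bound p #|S| <= #|nn S E x| + slack.
Proof.
move=> p2 st S0; have [ES pE stS] := st.
have [x xS maxx] := maxnn_exists E S0; exists x => //.
rewrite leqNgt; apply/negP=> big.
have [P maxP] := maxpacking_exists (star0 chi p E x).
have [starP _] := maxP; have kP := stS _ _ xS starP.
have low := part_bound_lower p1 S0; have cov := card_star_cover starP.
pose X := nb E x :\: cover P.
have cX : #|nb E x| <= #|X| + #|P| * p.
  rewrite -cov -(cardsID (cover P) (nb E x)) addnC leq_add2l subset_leq_card //.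
  apply/subsetP=> v; rewrite !inE => /andP[/andP[xv _] ->].
  by rewrite eq_sym xv.
have XS v : v \in X -> v \in S.
  by rewrite inE => /andP[_]; apply: (subsetP (nb_subset x ES)).
have [|||||Q [rQ xQ cQ QX]] :=
  @extend_rclique _ chi E #|nn S E x| p.+1 (nseq p X) [set x] pE.
- exact: rclique1.
- by rewrite cards1 size_nseq.
- move=> X' /nseqP[-> _] v; rewrite inE sub1set nbC => /andP[_].
  by rewrite nbC.
- have XX : [forall v in X, #|X :\: nb E v| <= #|nn S E x|].
    apply/forall_inP=> v vX; apply: leq_trans (maxx v (XS _ vX)).
    by apply/subset_leq_card/setSD/subsetP.
  elim: (p) => //= n ->; rewrite andbT all_nseq XX orbT //.
- move=> X' /nseqP[-> _]; rewrite size_nseq.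
  move: big; rewrite /slack; have := card_nn x ES.
  set h := part_bound p #|S| in low kP *.
  move: (p.+1 ^ 3) cX kP low; case: (p) p2 => [|q] //= q1 R cX kP low nS big.
  nia.
rewrite sub1set in xQ; rewrite cards1 size_nseq in cQ.
apply: (maxstar_blocks maxP xQ cQ rQ) => v /QX[|[X' /nseqP[-> _]]].
  by rewrite inE => /eqP->; rewrite eqxx.
by rewrite inE => /andP[].
Qed.
End Stars.

(* Triangles: for [p = 2] the greedy bound on stars is too weak, and maximum
   matchings in the neighbourhood of a vertex are used instead. *)
Section Triangles.
Variables (T : finType) (chi : {set T} -> nat).
Implicit Types (E : {set {set T}}) (Q S X : {set T}) (P : {set {set T}}).
Implicit Types (u v w x y z : T).

(* [u], [v], [v'], [u'] is an augmenting path for the matching [P] of the link. *)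
Lemma star_rotate E x P Q u u' v v' :
  proper chi E -> star chi 2 E x P -> Q \in P -> Q :\ x = [set v; v'] ->
  u != u' -> u \in nb E x :\: cover P -> u' \in nb E x :\: cover P ->
  v \in nb E u -> v' \in nb E u' ->
  exists2 P', star chi 2 E x P' & #|P| < #|P'|.
Proof.
move=> pE starP QP defQ uu' /setDP[ux uP] /setDP[u'x u'P] uv u'v'.
have [packP xP] := star_packingP _ _ _ _ _ starP.
have [PQ dis] := packingP _ _ _ _ packP.
have vQ : v \in Q :\ x by rewrite defQ set21.
have v'Q : v' \in Q :\ x by rewrite defQ set22.
have [[vx vQ0] [v'x v'Q0]] := (setD1P vQ, setD1P v'Q).
have vv' : v != v'.
  have [cQ _] := PQ Q QP; have := cardsD1 x Q; rewrite cQ xP // defQ cards2.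
  by case: (v != v').
have inP w : w \in Q -> w \in cover P by move=> wQ; apply/bigcupP; exists Q.
have nbx w : w \in Q -> w != x -> w \in nb E x.
  by move=> /inP; apply: star_cover_nb starP.
have neP a b : a \notin cover P -> b \in cover P -> a != b.
  by move=> aP bP; apply: contraNneq aP => ->.
have nex a : a \in nb E x -> a != x by rewrite in_nb eq_sym => /andP[].
have ux' := nex _ ux; have u'x' := nex _ u'x.
pose P0 := P :\ Q.
have P0_sub : cover P0 \subset cover P.
  by apply/bigcupsP=> Q' /setD1P[_ Q'P]; apply: bigcup_sup.
have starP0 : star chi 2 E x P0.
  apply/star_packingP; split=> [|Q' /setD1P[_ /xP]//].
  apply/packingP; split=> [Q' /setD1P[_ /PQ]//|Q1 Q2 a b /setD1P[_ Q1P] /setD1P[_]].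
  exact: dis.
have notP0 w : w \in Q -> w != x -> w \notin cover P0.
  move=> wQ wx; apply/bigcupP=> -[Q' /setD1P[/eqP neq Q'P] wQ'].
  by case: neq; apply: (dis _ _ w x); rewrite ?xP.
have tri a b : a \in nb E x -> b \in nb E x -> b \in nb E a ->
    rclique chi E (x |: [set a; b]) /\ #|x |: [set a; b]| = 3.
  move=> xa xb ab; split; first exact: rclique3.
  rewrite cardsU1 cards2 !inE !(eq_sym x) (negPf (nex _ xa)) (negPf (nex _ xb)).
  by move: ab; rewrite in_nb => /andP[->].
have [rQ1 cQ1] := tri u v ux (nbx v vQ0 vx) uv.
have [rQ2 cQ2] := tri u' v' u'x (nbx v' v'Q0 v'x) u'v'.
have [|starP1 Q1nP] := starU1 (ltnSn 1) starP0 (setU11 _ _) cQ1 rQ1.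
  move=> w; rewrite !inE => /or3P[/eqP->|/eqP->|/eqP-> _]; rewrite ?eqxx //.
    by move=> _; apply: contra uP; apply: (subsetP P0_sub).
  exact: notP0.
have coverU w A B : w \notin cover A -> w \notin (B : {set T}) ->
    w \notin cover (B |: A).
  move=> wA wB; apply/bigcupP=> -[B' /setU1P[->|B'A] wB']; first by rewrite wB' in wB.
  by case/bigcupP: wA; exists B'.
have [|starP2 Q2nP] := starU1 (ltnSn 1) starP1 (setU11 _ _) cQ2 rQ2.
  move=> w; rewrite !inE => /or3P[/eqP->|/eqP->|/eqP->]; rewrite ?eqxx // => _.
    apply: coverU; first by apply: contra u'P; apply: (subsetP P0_sub).
    by rewrite !inE (negPf u'x') eq_sym (negPf uu') (negPf (neP _ _ u'P (inP _ vQ0))).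
  apply: coverU; first exact: notP0.
  rewrite !inE (negPf v'x) eq_sym (negPf (neP _ _ uP (inP _ v'Q0))).
  by rewrite eq_sym (negPf vv').
exists (x |: [set u'; v'] |: (x |: [set u; v] |: P0)) => //.
rewrite cardsU1 Q2nP cardsU1 Q1nP !add1n (cardsD1 Q P) QP.
exact: leqnn.
Qed.

(** Hall's condition for two sets. Applied to a matched pair [D] and the neighbours in it of two
    unmatched vertices, it provides an augmenting path. *)
Lemma distinct_representatives (A B D : {set T}) :
  A \subset D -> B \subset D -> #|D| <= 2 -> 2 < #|A| + #|B| ->
  exists a b, [/\ a \in A, b \in B & a != b].
Proof.
move=> /subset_leq_card AD /subset_leq_card BD D2 big.
have /card_gt0P[a aA] : 0 < #|A| by lia.
have /card_gt0P[b bB] : 0 < #|B| by lia.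
have [ab|ab] := eqVneq a b; last by exists a, b.
have [A2|A1] := leqP 2 #|A|.
  have /card_gt0P[a' /setD1P[a'a a'A]] : 0 < #|A :\ a|.
    by have := cardsD1 a A; rewrite aA; lia.
  by exists a', b; rewrite -ab in bB *.
have /card_gt0P[b' /setD1P[b'b b'B]] : 0 < #|B :\ b|.
  by have := cardsD1 b B; rewrite bB; lia.
by exists a, b'; rewrite ab eq_sym in aA *.
Qed.

(** Inside the link of [x], an unmatched vertex has no unmatched neighbour, since this would give a
    new triangle. A matched pair receives at most two edges from [u] and [u'] together, since three
    would contain an augmenting path. *)
Lemma unmatched_degrees E x P u u' :
  proper chi E -> maxpacking (star chi 2 E x) P ->
  u != u' -> u \in nb E x :\: cover P -> u' \in nb E x :\: cover P ->
  #|nb E u :&: nb E x| + #|nb E u' :&: nb E x| <= 2 * #|P|.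
Proof.
move=> pE [starP maxP] uu' uX u'X.
have [packP xP] := star_packingP _ _ _ _ _ starP.
have [PQ _] := packingP _ _ _ _ packP.
have nex a : a \in nb E x -> a != x by rewrite in_nb eq_sym => /andP[].
have cov a : a \in nb E x :\: cover P ->
    #|nb E a :&: nb E x| <= \sum_(Q in P) #|nb E a :&: (Q :\ x)|.
  move=> /setDP[xa aP].
  apply: (@leq_trans #|\bigcup_(Q in P) (nb E a :&: (Q :\ x))|).
    apply: subset_leq_card; apply/subsetP=> w /setIP[aw xw].
    have [/bigcupP[Q QP wQ]|wP] := boolP (w \in cover P).
      by apply/bigcupP; exists Q; rewrite // !in_setI aw in_setD1 wQ nex.
    have cQ : #|x |: [set a; w]| = 3.
      rewrite cardsU1 cards2 !inE !(eq_sym x) (negPf (nex _ xa)) (negPf (nex _ xw)).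
      by move: aw; rewrite in_nb => /andP[->].
    case: (maxstar_blocks (ltnSn 1) (conj starP maxP) (setU11 _ _) cQ).
      exact: rclique3.
    by move=> b; rewrite !inE => /or3P[/eqP->|/eqP->|/eqP->]; rewrite ?eqxx.
  elim/big_rec2: _ => [|Q m B _ le]; first by rewrite cards0.
  by apply: leq_trans (leq_card_setU _ _) _; rewrite leq_add2l.
apply: leq_trans (leq_add (cov _ uX) (cov _ u'X)) _.
rewrite -big_split /= mulnC -sum_nat_const; apply: leq_sum => Q QP.
have [cQ _] := PQ Q QP.
have cQx : #|Q :\ x| = 2 by have := cardsD1 x Q; rewrite cQ xP // add1n => -[->].
rewrite leqNgt; apply/negP; set A := _ :&: _; set B := _ :&: _ => big.
have AQ : A \subset Q :\ x by apply: subsetIr.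
have BQ : B \subset Q :\ x by apply: subsetIr.
have no a b : a \in A -> b \in B -> a != b -> False.
  move=> aA bB ab; have defQ : Q :\ x = [set a; b].
    apply/esym/eqP; rewrite eqEcard cards2 ab cQx andbT.
    by apply/subsetP=> w /set2P[]->; [apply: (subsetP AQ) | apply: (subsetP BQ)].
  move: aA bB => /setIP[ua _] /setIP[u'b _].
  have [P' starP' lt] := star_rotate pE starP QP defQ uu' uX u'X ua u'b.
  by have := maxP _ starP'; rewrite leqNgt lt.
have [a [b [aA bB ab]]] := distinct_representatives AQ BQ (eq_leq cQx) big.
exact: no ab.
Qed.

(** A Dirac-type bound: two unmatched vertices would have degree sum at least [2 k] in the link,
    against at most [2 * #|P|]. *)
Lemma maxstar_unmatched E x P k : proper chi E ->
  maxpacking (star chi 2 E x) P ->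
  (forall u, u \in nb E x -> k <= #|nb E u :&: nb E x|) -> #|P| < k ->
  #|nb E x| <= 2 * #|P| + 1.
Proof.
move=> pE maxP deg lt; have [starP _] := maxP.
have cov := card_star_cover starP.
rewrite leqNgt; apply/negP=> big.
have /card_gt1P[u [u' [uX u'X uu']]] : 1 < #|nb E x :\: cover P|.
  have := cardsID (cover P) (nb E x).
  suff : #|nb E x :&: cover P| <= #|cover P :\ x| by lia.
  apply/subset_leq_card/subsetP=> w; rewrite !inE => /andP[/andP[xw _] ->].
  by rewrite eq_sym xw.
have := unmatched_degrees pE maxP uu' uX u'X.
have [[xu _] [xu' _]] := (setDP uX, setDP u'X).
by have := deg u xu; have := deg u' xu'; lia.
Qed.

Lemma codegree_lower S E x u : E \subset pairs S ->
  #|nb E x| <= #|nb E u :&: nb E x| + #|nn S E u|.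
Proof.
move=> ES; rewrite -(cardsID (nb E u) (nb E x)) setIC leq_add2l.
by apply/subset_leq_card/setSD/nb_subset.
Qed.

(** Write [h] for [part_bound 2 #|S|] and [m] for the largest [#|nn S E v|], attained at [x]. If [m]
    is far below [h], the link of [x] has minimum degree at least [#|S| - 2 m], more than the
    [h - m] allowed for [#|P|], so at most one neighbour is unmatched. Then
    [#|S| - m <= 2 (h - m) + 1], and [2 h <= #|S| + 1] leaves [m <= 2]. *)
Lemma stuck_sparse_vertex_2 S E : stuck chi 2 S E -> 0 < #|S| ->
  (exists2 x, x \in S & part_bound 2 #|S| <= #|nn S E x| + slack 2) \/
  (forall v, v \in S -> #|nn S E v| <= 2).
Proof.
move=> st S0; have [ES pE stS] := st.
have [x xS maxx] := maxnn_exists E S0.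
have [le|big] := leqP (part_bound 2 #|S|) (#|nn S E x| + slack 2).
  by left; exists x.
right=> v vS; apply: leq_trans (maxx v vS) _.
have [P maxP] := maxpacking_exists (star0 chi 2 E x).
have [starP _] := maxP; have := stS _ _ xS starP; rewrite muln1 => kP.
have low := part_bound_lower (ltnSn 1) S0.
have [k nk] : exists k, #|nb E x| = k + #|nn S E x|.
  exists (#|nb E x| - #|nn S E x|); rewrite subnK //.
  by have := card_nn x ES; move: big; rewrite /slack; lia.
have deg u : u \in nb E x -> k <= #|nb E u :&: nb E x|.
  move=> xu; have uS := subsetP (nb_subset x ES) u xu.
  by have := codegree_lower x u ES; have := maxx u uS; lia.
have lt : #|P| < k by have := card_nn x ES; move: big; rewrite /slack; lia.
by have := maxstar_unmatched pE maxP deg lt; have := card_nn x ES; lia.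
Qed.

Lemma maxstar_near_perfect S E b x P : proper chi E -> E \subset pairs S ->
  maxpacking (star chi 2 E x) P -> (forall v, v \in S -> #|nn S E v| <= b) ->
  3 * b < #|S| -> x \in S -> #|nb E x| <= 2 * #|P| + 1.
Proof.
move=> pE ES maxP nnb bS xS.
have [lt|] := ltnP #|P| (#|nb E x| - b); last first.
  by have := card_nn x ES; have := nnb x xS; lia.
apply: maxstar_unmatched lt => // u xu.
have uS := subsetP (nb_subset x ES) u xu.
by have := codegree_lower x u ES; have := nnb u uS; lia.
Qed.

Lemma cardsD2 Q x v k : #|Q| = k.+2 -> x \in Q -> v \in Q -> v != x ->
  #|Q :\ x :\ v| = k.
Proof.
move=> cQ xQ vQ vx; have := cardsD1 x Q; rewrite cQ xQ add1n => -[].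
by rewrite (cardsD1 v (Q :\ x)) in_setD1 vx vQ add1n => -[].
Qed.

(** An almost perfect matching of the link together with [1 <= #|nn S E x|] makes the gain
    [#|P| + #|nn S E x|] reach [part_bound 2 #|S|]. Star triangles share only [x], so a remaining
    vertex loses at most the edge to its partner, and a matched one does lose it. *)
Lemma peel_lossless S E g b x : proper chi E -> excess chi 2 S E g ->
  (forall v, v \in S -> #|nn S E v| <= b) -> 3 * b < #|S| -> x \in S ->
  exists P E', [/\ E' \subset E, excess chi 2 (S :\ x) E' g,
    #|S| <= #|cover P :\ x| + b + 1,
    forall v, v \in S :\ x -> #|nn (S :\ x) E' v| <= #|nn S E v| + 1 &
    forall v, v \in cover P :\ x -> v \in S /\
      #|nn S E v| + 1 <= #|nn (S :\ x) E' v| ].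
Proof.
move=> pE exc nnb bS xS; have [ES _] := exc.
have [P maxP] := maxpacking_exists (star0 chi 2 E x).
have [starP _] := maxP; have cov := card_star_cover starP.
have [packP xP] := star_packingP _ _ _ _ _ starP.
have [PQ dis] := packingP _ _ _ _ packP.
have nS := card_nn x ES; have nbx := nnb x xS.
have matched := maxstar_near_perfect pE ES maxP nnb bS xS.
have x_nn : 0 < #|nn S E x| by apply/card_gt0P; exists x; rewrite inE nb_irr.
exists P, (peeled E x P); split.
- exact: peeled_sub.
- apply: peel exc xS starP _ => //.
  have S0 : 0 < #|S| by lia.
  by have := part_bound_lower (ltnSn 1) S0; lia.
- by lia.
- move=> v /setD1P[vx vS].
  suff [D cD sub] : exists2 D : {set T}, #|D| <= 1 &
      nn (S :\ x) (peeled E x P) v \subset nn S E v :|: D.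
    apply: leq_trans (subset_leq_card sub) _.
    by apply: leq_trans (leq_card_setU _ _) _; rewrite leq_add2l.
  pose D := \bigcup_(Q in P | v \in Q) (Q :\ x :\ v).
  exists D; last first.
    apply/subsetP=> w; rewrite in_setD => /andP[nw /setD1P[wx wS]].
    rewrite in_setU in_setD wS andbT; apply/orP.
    have [vw|] := boolP (w \in nb E v); last by left.
    right; move: nw; move: (vw); rewrite !in_nb => /andP[nvw vwE].
    rewrite nvw /= /peeled in_setD vwE andbT negbK in_setU => /orP[].
      by rewrite !inE !(eq_sym x) (negPf vx) (negPf wx) andbF.
    case/bigcupP=> Q QP; rewrite mem_pairs2 !in_setD1 => /and3P[/andP[_ vQ] wQ _].
    by apply/bigcupP; exists Q; rewrite ?QP // in_setD1 eq_sym nvw in_setD1.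
  have [/bigcupP[Q QP vQ]|vP] := boolP (v \in cover P).
    apply: (@leq_trans #|Q :\ x :\ v|).
      apply/subset_leq_card/bigcupsP=> Q' /andP[Q'P vQ'].
      by rewrite (dis Q' Q v x) ?xP.
    by have [cQ _] := PQ Q QP; rewrite (cardsD2 cQ) ?xP.
  rewrite /D big_pred0 ?cards0 // => Q; apply/andP=> -[QP vQ].
  by case/bigcupP: vP; exists Q.
move=> v /setD1P[vx vP]; have xv := star_cover_nb starP vP vx.
have vS : v \in S by apply: (subsetP (nb_subset x ES)).
split=> //; have /bigcupP[Q QP vQ] := vP.
have [cQ rQ] := PQ Q QP.
have /card_gt0P[w /setD1P[wv /setD1P[wx wQ]]] : 0 < #|Q :\ x :\ v|.
  by rewrite (cardsD2 cQ) ?xP.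
have vw : w \in nb E v by apply: rclique_nb rQ _ _ _; rewrite // eq_sym.
apply: (@leq_trans #|w |: nn S E v|).
  by rewrite cardsU1 in_setD vw addnC.
apply/subset_leq_card/subsetP=> y; rewrite in_setU1 => /predU1P[->|].
  rewrite in_setD in_setD1 wx (subsetP (nb_subset v ES)) // !andbT.
  rewrite in_nb /peeled in_setD in_setU; apply/negP.
  move=> /andP[_] /andP[/norP[_ /bigcupP nP] _]; apply: nP.
  by exists Q; rewrite // mem_pairs2 !in_setD1 vx vQ wx wQ eq_sym.
case/setDP=> yS yv; rewrite in_setD in_setD1 yS andbT; apply/andP; split.
  by apply: contra yv; apply/subsetP/nbS/peeled_sub.
by apply: contraNneq yv => ->; rewrite nbC.
Qed.

(* In a nearly complete graph a peeling need not gain, but it never loses and it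
   lowers the degree of matched vertices: a vertex matched twice gains. *)
Lemma three_peels S E g : proper chi E -> excess chi 2 S E g ->
  (forall v, v \in S -> #|nn S E v| <= 2) -> 20 < #|S| ->
  exists S' E', [/\ E' \subset E, #|S| = #|S'| + 3 & excess chi 2 S' E' g.+1].
Proof.
move=> pE exc nn2 S20.
have /card_gt0P[x xS] : 0 < #|S| by lia.
have [|P1 [E1 [E1E exc1 cov1 nn1 cov1nn]]] := peel_lossless pE exc nn2 _ xS.
  by lia.
have cS1 := cardsD1 x S; rewrite xS in cS1.
have pE1 := properS E1E pE.
have nn3 v : v \in S :\ x -> #|nn (S :\ x) E1 v| <= 3.
  move=> vS; apply: leq_trans (nn1 v vS) _; rewrite addn1 ltnS nn2 //.
  by have /setD1P[] := vS.
have /card_gt0P[y yS] : 0 < #|S :\ x| by lia.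
have [|P2 [E2 [E2E1 exc2 cov2 nn2' cov2nn]]] := peel_lossless pE1 exc1 nn3 _ yS.
  by lia.
have cS2 := cardsD1 y (S :\ x); rewrite yS in cS2.
pose C1 := cover P1 :\ x; pose C2 := cover P2 :\ y.
have C1S : C1 \subset S :\ x.
  by apply/subsetP=> v vC; rewrite in_setD1; have /setD1P[-> _] := vC; have [->] := cov1nn v vC.
have C2S : C2 \subset S :\ x by apply/subsetP=> v vC; have [->] := cov2nn v vC.
have /card_gt0P[z /setIP[zC1 zC2]] : 0 < #|C1 :&: C2|.
  have := cardsUI C1 C2.
  have : #|C1 :|: C2| <= #|S :\ x| by rewrite subset_leq_card // subUset C1S.
  by move: cov1 cov2 cS1 S20; rewrite -/C1 -/C2; clear; lia.
have [zS nnz1] := cov1nn z zC1; have [zS1 nnz2] := cov2nn z zC2.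
have zS2 : z \in S :\ x :\ y by rewrite in_setD1 zS1; have /setD1P[->] := zC2.
have pE2 := properS E2E1 pE1.
have [E2S _] := exc2.
have nn4 v : v \in S :\ x :\ y -> #|nn (S :\ x :\ y) E2 v| <= 4.
  move=> vS; apply: leq_trans (nn2' v vS) _; rewrite addn1 ltnS nn3 //.
  by have /setD1P[] := vS.
have z_nn : 0 < #|nn S E z| by apply/card_gt0P; exists z; rewrite inE nb_irr.
(* [z] counts itself and one lost partner from each of the two peelings. Three is what turns the
   rounding in [2 * part_bound 2 s <= s + 1] into a strict gain at [z]. *)
have nnz : 2 < #|nn (S :\ x :\ y) E2 z|.
  by move: nnz1 nnz2 z_nn; clear; lia.
have S12 : 12 < #|S :\ x :\ y| by move: cS1 cS2 S20; clear; lia.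
have [P3 maxP3] := maxpacking_exists (star0 chi 2 E2 z).
have matched := maxstar_near_perfect pE2 E2S maxP3 nn4 S12 zS2.
have [starP3 _] := maxP3; have nz := card_nn z E2S.
exists (S :\ x :\ y :\ z), (peeled E2 z P3); split.
- apply: subset_trans (peeled_sub _ _ _) _.
  exact: subset_trans E2E1 E1E.
- have := cardsD1 z (S :\ x :\ y); rewrite zS2.
  by move: cS1 cS2; clear; lia.
apply: peel exc2 zS2 starP3 _ => //.
have := part_bound_lower (ltnSn 1) (leq_ltn_trans (leq0n _) S12).
by move: nnz nz matched; clear; rewrite muln1; lia.
Qed.
End Triangles.

(** * Structure of graphs with no gaining star *)

Section Classes.
Variables (T : finType) (chi : {set T} -> nat) (p : nat).
Hypothesis p1 : 1 < p.
Implicit Types (E : {set {set T}}) (Q S X : {set T}) (P : {set {set T}}).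
Implicit Types (u v w x y z : T).

(** [#|S|] exceeds [p * part_bound p #|S| - p], and the other [p - 1] sets take at most
    [part_bound p #|S|] each, so almost as much is left for [A i]. *)
Lemma class_lower S (A : 'I_p -> {set T}) B i : 0 < #|S| ->
  (forall j, #|A j| <= part_bound p #|S|) ->
  #|S :\: \bigcup_j A j| <= B -> part_bound p #|S| <= #|A i| + B + p.
Proof.
move=> S0 Ah WB; have low := part_bound_lower p1 S0.
have Sle : #|S| <= #|S :\: \bigcup_j A j| + #|\bigcup_j A j|.
  by rewrite -[X in X <= _](cardsID (\bigcup_j A j) S) addnC leq_add2l
     subset_leq_card ?subsetIr.
have : #|\bigcup_j A j| <= #|A i| + p.-1 * part_bound p #|S|.
  rewrite (bigD1 i) //=; apply: leq_trans (leq_card_setU _ _) _.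
  rewrite leq_add2l; have -> : p.-1 = #|[set~ i]| by rewrite cardsC1 card_ord.
  rewrite (eq_bigl [in [set~ i]]); last by move=> j; rewrite !inE.
  exact: card_bigcup_le.
have : p * part_bound p #|S| = p.-1 * part_bound p #|S| + part_bound p #|S|.
  by rewrite -mulSnr prednK; lia.
by lia.
Qed.

(** At a sparse vertex of a stuck graph a star has at most [slack p] cliques, each on [p.+1]
    vertices. *)
Definition cover_slack := p.+1 * slack p.
Definition clash_slack := p.+1 ^ 3.

(* [x] lies in a rainbow [K_p] avoiding a maximum star at [x]; its vertices have
   few common neighbours, so almost every vertex misses exactly one of them. *)
Lemma base_clique S E x : stuck chi p S E -> x \in S ->
  part_bound p #|S| <= #|nn S E x| + slack p ->
  p + cover_slack + clash_slack < part_bound p #|S| ->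
  exists P (u : 'I_p -> T), [/\ maxpacking (star chi p E x) P,
    #|cover P| <= cover_slack, injective u &
    [/\ exists i, u i = x, rclique chi E (u @: setT), forall i, u i \in S &
     forall i, u i != x -> u i \notin cover P]].
Proof.
move=> st xS sparse hbig; have [ES pE stS] := st.
have S0 : 0 < #|S| by apply/card_gt0P; exists x.
have low := part_bound_lower p1 S0.
have [P maxP] := maxpacking_exists (star0 chi p E x).
have [starP _] := maxP; have kP := stS _ _ xS starP.
have [packP _] := star_packingP _ _ _ _ _ starP.
have covP : #|cover P| <= cover_slack.
  apply: leq_trans (card_cover_le packP) _; rewrite mulnC leq_pmul2l //.
  have : #|P| <= #|P| * p.-1 by apply: leq_pmulr; lia.
  by lia.
pose X := nb E x :\: cover P.
have XS v : v \in X -> v \in S.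
  by rewrite inE => /andP[_]; apply: (subsetP (nb_subset x ES)).
have [|||||Q [rQ xQ cQ QX]] :=
  @extend_rclique _ chi E (part_bound p #|S|) p.+1 (nseq p.-1 X) [set x] pE.
- exact: rclique1.
- by rewrite cards1 size_nseq; lia.
- move=> X' /nseqP[-> _] v; rewrite inE sub1set nbC => /andP[_].
  by rewrite nbC.
- have XX : [forall v in X, #|X :\: nb E v| <= part_bound p #|S|].
    apply/forall_inP=> v vX; apply: leq_trans (stuck_nn st (XS _ vX)).
    by apply/subset_leq_card/setSD/subsetP.
  elim: (p.-1) => //= n ->; rewrite andbT all_nseq XX orbT //.
- move=> X' /nseqP[-> _]; rewrite size_nseq -/clash_slack.
  have := card_nn x ES; have := stuck_nn st xS.
  have : #|nb E x| <= #|X| + #|cover P|.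
    rewrite -(cardsID (cover P) (nb E x)) addnC leq_add2l subset_leq_card //.
    exact: subsetIr.
  set h := part_bound p #|S| in low hbig *.
  (* [S] has more than [p * h - p] vertices; [x] and the degree demand of the greedy choice take at
     most [(p - 1) * h] of them, and the last [h] exceeds [p + cover_slack + clash_slack]. *)
  have : p * h = p.-1.-1 * h + h + h by rewrite -!mulSnr !prednK; lia.
  by lia.
rewrite sub1set in xQ.
have cQp : p = #|Q| by rewrite cQ cards1 size_nseq; lia.
exists P, (fun i : 'I_p => enum_val (cast_ord cQp i)).
have uQ i : enum_val (cast_ord cQp i) \in Q by apply: enum_valP.
have imu : [set enum_val (cast_ord cQp i) | i in [set: 'I_p]] = Q.
  apply/setP=> v; apply/imsetP/idP => [[i _ ->]|vQ]; first exact: uQ.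
  exists (cast_ord (esym cQp) (enum_rank_in vQ v)) => //.
  by rewrite cast_ordKV enum_rankK_in.
split=> //; first by move=> i j /enum_val_inj/cast_ord_inj.
split.
- exists (cast_ord (esym cQp) (enum_rank_in xQ x)).
  by rewrite cast_ordKV enum_rankK_in.
- by rewrite imu.
- move=> i; have [|[X' /nseqP[-> _]]] := QX _ (uQ i); last exact: XS.
  by rewrite inE => /eqP->.
move=> i; have [|[X' /nseqP[-> _]]] := QX _ (uQ i).
  by rewrite inE => ->.
by rewrite inE => /andP[].
Qed.

Section Exchange.
Variables (S : {set T}) (E : {set {set T}}) (x : T) (P : {set {set T}}).
Variable u : 'I_p -> T.
Hypothesis st : stuck chi p S E.
Hypothesis maxP : maxpacking (star chi p E x) P.
Hypothesis covP : #|cover P| <= cover_slack.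
Hypothesis uinj : injective u.
Hypothesis rK : rclique chi E (u @: setT).
Hypothesis uS : forall i, u i \in S.
Hypothesis ux : forall i, u i != x -> u i \notin cover P.
Variable i0 : 'I_p.
Hypothesis ui0 : u i0 = x.

Let h := part_bound p #|S|.

Definition missed v : {set 'I_p} := [set j | v \notin nb E (u j)].
Lemma in_missed v j : (j \in missed v) = (v \notin nb E (u j)).
Proof. by rewrite in_set. Qed.

(** In a complete [p]-partite graph this is the part of [u i]. *)
Definition class i : {set T} := [set v in S | missed v == [set i]].
Definition class_slack := 2 * (cover_slack + clash_slack) + p.

Lemma classP i v :
  reflect (v \in S /\ forall j, (v \in nb E (u j)) = (j != i)) (v \in class i).
Proof.
rewrite inE; apply: (iffP andP) => -[vS].
  move=> /eqP/setP mv; split=> // j; move: (mv j); rewrite in_missed in_set1.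
  by move/negbRL.
by move=> mv; split=> //; apply/eqP/setP=> j; rewrite in_missed mv in_set1 negbK.
Qed.

Lemma class_sub i : class i \subset S.
Proof. by apply/subsetP=> v /classP[]. Qed.

Lemma class_le i : #|class i| <= h.
Proof.
apply: leq_trans (stuck_nn st (uS i)); apply/subset_leq_card/subsetP=> v.
by case/classP=> vS mv; rewrite in_setD mv eqxx vS.
Qed.

Lemma class_disjoint i j v : v \in class i -> v \in class j -> i = j.
Proof. by rewrite !inE => /andP[_ /eqP->] /andP[_ /eqP/set1_inj]. Qed.

(** A common neighbour of all [u i] outside the star and outside [clash] would complete them to a
    rainbow [K_r] through [x] that enlarges the maximum star. *)
Lemma card_common :
  #|[set v in S | missed v == set0]| <= cover_slack + clash_slack.
Proof.
have [ES pE stS] := st; have [starP _] := maxP.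
have cK : #|u @: setT| = p by rewrite card_imset // cardsT card_ord.
have cl : #|clash chi E (u @: setT)| <= clash_slack.
  by apply: card_clash => //; rewrite cK.
apply: (@leq_trans #|cover P :|: clash chi E (u @: setT)|); last first.
  by apply: leq_trans (leq_card_setU _ _) _; rewrite leq_add.
apply/subset_leq_card/subsetP=> v; rewrite inE => /andP[vS /eqP mv].
rewrite in_setU; apply/negPn/negP; rewrite negb_or => /andP[vP vcl].
have adj j : u j \in nb E v.
  by have := in_set0 j; rewrite -mv in_missed nbC => /negbFE.
have vK : v \notin u @: setT.
  by apply/imsetP=> -[j _ vj]; have := adj j; rewrite vj nb_irr.
have xK : x \in u @: setT by rewrite -ui0 imset_f.
apply: (maxstar_blocks p1 maxP (Q := v |: (u @: setT))).
- by rewrite in_setU1 xK orbT.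
- by rewrite cardsU1 vK cK.
- by apply: rcliqueU1 => //; apply/subsetP=> w /imsetP[j _ ->].
by move=> w /setU1P[->//|/imsetP[j _ ->]]; apply: ux.
Qed.

(** Double counting of non-adjacencies: the [u j] miss at most [p * h <= #|S| + p] vertices in all.
    A vertex in a class is missed once, a common neighbour never, and any other vertex at least
    twice; the weight 2 on common neighbours makes up for their deficit. *)
Lemma card_unclassed : #|S :\: \bigcup_i class i| <= class_slack.
Proof.
have S0 : 0 < #|S| by apply/card_gt0P; exists (u i0).
have low := part_bound_lower p1 S0.
have sum_missed : \sum_(v in S) #|missed v| <= p * h.
  have -> : \sum_(v in S) #|missed v| = \sum_j #|nn S E (u j)|.
    have -> : \sum_(v in S) #|missed v| =
        \sum_(v in S) \sum_(j | v \notin nb E (u j)) 1.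
      by apply: eq_bigr => v _; rewrite -sum1_card; apply: eq_bigl => j; rewrite in_missed.
    rewrite (exchange_big_dep predT) //=; apply: eq_bigr => j _.
    by rewrite -sum1_card; apply: eq_bigl => v; rewrite in_setD andbC.
  rewrite -[X in _ <= X * h]card_ord -sum_nat_const; apply: leq_sum => j _.
  exact: stuck_nn st (uS j).
have common := card_common; set CN := [set v in S | _] in common.
suff : #|S| + #|S :\: \bigcup_i class i| <=
    \sum_(v in S) #|missed v| + 2 * #|CN|.
  by rewrite /class_slack; move: low; rewrite -/h; lia.
set W := S :\: _.
have cW : #|W| = \sum_(v in S) (v \in W).
  rewrite -sum1_card [RHS]big_mkcond [LHS]big_mkcond; apply: eq_bigr => v _.
  by rewrite /W in_setD andbC; case: (v \in S).
have cC : #|CN| = \sum_(v in S) (v \in CN).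
  rewrite -sum1_card [RHS]big_mkcond [LHS]big_mkcond; apply: eq_bigr => v _.
  by rewrite inE; case: (v \in S).
rewrite cW cC -[#|S|]sum1_card big_distrr /= -!big_split /=.
apply: leq_sum => v vS; rewrite in_setD vS andbT [v \in CN]inE vS /=.
case: (eqVneq (missed v) set0) => [->|nz]; first by rewrite cards0; case: (_ \notin _).
have pos : 0 < #|missed v| by rewrite card_gt0.
have [/bigcupP[i _ vi]|vU] /= := boolP (v \in \bigcup_i class i).
  by rewrite muln0 !addn0.
suff m1 : #|missed v| != 1.
  by rewrite muln0 addn0 ltn_neqAle eq_sym m1.
apply: contra vU => /cards1P[i mv]; apply/bigcupP; exists i => //.
by rewrite inE vS mv eqxx.
Qed.

Lemma class_ge i : h <= #|class i| + class_slack + p.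
Proof.
apply: class_lower => //; [|exact: class_le|exact: card_unclassed].
by apply/card_gt0P; exists (u i0).
Qed.

(** Discarded are the vertices of the star and those that would repeat a colour when put in the
    place of [u i]. *)
Definition core i : {set T} :=
  class i :\: (cover P :|: clash chi E (u @: [set~ i])).

Definition core_slack := p + class_slack + clash_slack + cover_slack.

Lemma core_sub i : core i \subset class i. Proof. exact: subsetDl. Qed.

Lemma class_core i : #|class i :\: core i| <= cover_slack + clash_slack.
Proof.
have [ES pE stS] := st.
have cl : #|clash chi E (u @: [set~ i])| <= clash_slack.
  apply: card_clash => //; rewrite card_imset // cardsC1 card_ord; lia.
rewrite /core setDDr setDv set0U.
apply: leq_trans (subset_leq_card (subsetIr _ _)) _.
by apply: leq_trans (leq_card_setU _ _) _; rewrite leq_add.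
Qed.

(* Exchanging [u i] for [v] gives another rainbow [K_p] through [x], with few
   common neighbours again. *)
Lemma core_inner i v : i != i0 -> v \in core i ->
  #|class i :&: nb E v| <= cover_slack + clash_slack.
Proof.
move=> ii0; have [ES pE stS] := st.
rewrite in_setD in_setU negb_or => /andP[/andP[vP vcl] vi].
pose K := u @: [set~ i].
have cK : #|K| = p.-1 by rewrite card_imset // cardsC1 card_ord.
have nbK w : w \in class i -> K \subset nb E w.
  case/classP=> _ mw; apply/subsetP=> _ /imsetP[j + ->].
  by rewrite nbC mw in_setC1.
have rvK : rclique chi E (v |: K).
  apply: rcliqueU1 => //; last exact: nbK.
  by apply: rclique_subset rK; apply: imsetS; apply: subsetT.
have nK w : w \in class i -> w \notin K.
  by move=> /nbK/subsetP sub; apply/negP=> /sub; rewrite nb_irr.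
have cvK : #|v |: K| = p by rewrite cardsU1 (nK v vi) cK; lia.
have cl : #|clash chi E (v |: K)| <= clash_slack by apply: card_clash => //; rewrite cvK.
apply: (@leq_trans #|cover P :|: clash chi E (v |: K)|); last first.
  by apply: leq_trans (leq_card_setU _ _) _; rewrite leq_add.
apply/subset_leq_card/subsetP=> w /setIP[wi vw].
rewrite in_setU; apply/negPn/negP; rewrite negb_or => /andP[wP wcl].
have wvK : w \notin v |: K.
  rewrite in_setU1 negb_or nK // andbT.
  by move: vw; rewrite in_nb eq_sym => /andP[].
apply: (maxstar_blocks p1 maxP (Q := w |: (v |: K))).
- rewrite !in_setU1; apply/orP; right; apply/orP; right.
  by rewrite -ui0 imset_f // !inE eq_sym.
- by rewrite cardsU1 wvK cvK.
- by apply: rcliqueU1; rewrite // subUset sub1set nbC vw nbK.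
move=> y /setU1P[->//|/setU1P[->//|/imsetP[j _ ->]]]; exact: ux.
Qed.

(** [v] misses at most [h] vertices in all, and by [core_inner] its own class already accounts for
    nearly that many. *)
Lemma core_outer i v : i != i0 -> v \in core i ->
  #|(S :\: class i) :\: nb E v| <= core_slack.
Proof.
move=> ii0 vi; have inner := core_inner ii0 vi; have lower := class_ge i.
have vS : v \in S := subsetP (subset_trans (core_sub i) (class_sub i)) v vi.
have := stuck_nn st vS; rewrite -/h.
have -> : #|nn S E v| = #|class i :\: nb E v| + #|(S :\: class i) :\: nb E v|.
  rewrite -(cardsID (class i) (nn S E v)); congr (_ + _); apply: eq_card => w.
    rewrite in_setI !in_setD; have [/classP[-> _]|] := boolP (w \in class i).
      by rewrite !andbT.
    by rewrite !andbF.
  by rewrite !in_setD; case: (_ \in class i); case: (w \in S); rewrite ?andbF ?andbT.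
by have := cardsID (nb E v) (class i); rewrite /core_slack; lia.
Qed.
End Exchange.
End Classes.

(** * From classes to independent parts *)

Section Parts.
Variables (T : finType) (chi : {set T} -> nat) (p : nat).
Hypothesis p1 : 1 < p.
Implicit Types (E : {set {set T}}) (Q S X : {set T}) (P : {set {set T}}).
Implicit Types (u v w x y z : T).

Lemma extend_transversal (I : finType) E D k Q (J : {set I}) (X : I -> {set T}) :
  proper chi E -> rclique chi E Q -> #|Q| + #|J| <= k ->
  (forall j v, j \in J -> v \in X j -> Q \subset nb E v) ->
  (forall j j' v, j \in J -> j' \in J -> j != j' -> v \in X j ->
     #|X j' :\: nb E v| <= D) ->
  (forall j, j \in J -> #|J| * D + k ^ 3 < #|X j|) ->
  exists Q', [/\ rclique chi E Q', Q \subset Q', #|Q'| = #|Q| + #|J| &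
     forall v, v \in Q' -> v \in Q \/ exists2 j, j \in J & v \in X j].
Proof.
move=> pE rQ szQ adjX missX bigX.
pose Xs := [seq X j | j <- enum J].
have sz : size Xs = #|J| by rewrite size_map -cardE.
have XsP Y : Y \in Xs -> exists2 j, j \in J & Y = X j.
  by case/mapP=> j; rewrite mem_enum => jJ ->; exists j.
have [|Y YXs||Y YXs|Q' [rQ' QQ' cQ' memQ']] := @extend_rclique _ chi E D k Xs Q pE rQ.
- by rewrite sz.
- by have [j jJ ->] := XsP Y YXs => v; apply: adjX.
- rewrite pairwise_map.
  have: pairwise [rel j j' | j != j'] (enum J) by rewrite -uniq_pairwise enum_uniq.
  apply: sub_in_pairwise (allss _) => j j' /=; rewrite !mem_enum => jJ j'J jj'.
  by apply/forall_inP=> v; apply: missX.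
- have [j jJ ->] := XsP Y YXs; rewrite sz; apply: leq_ltn_trans (bigX j jJ).
  by rewrite leq_add2r leq_mul2r leq_pred orbT.
exists Q'; split=> //; first by rewrite cQ' sz.
move=> v /memQ'[vQ|[Y /XsP[j jJ ->] vX]]; [by left | by right; exists j].
Qed.

Lemma classes_exist S E x : stuck chi p S E -> x \in S ->
  part_bound p #|S| <= #|nn S E x| + slack p ->
  p + cover_slack p + clash_slack p < part_bound p #|S| ->
  exists (A C : 'I_p -> {set T}) i0, [/\ forall i, A i \subset S,
    forall i j v, v \in A i -> v \in A j -> i = j,
    #|S :\: \bigcup_i A i| <= class_slack p /\
      (forall i, #|A i| <= part_bound p #|S| <= #|A i| + class_slack p + p),
    forall j, j != i0 -> A j \subset nb E x &
  [/\ forall i, C i \subset A i,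
    forall i, #|A i :\: C i| <= cover_slack p + clash_slack p,
    forall i v, i != i0 -> v \in C i ->
      #|(S :\: A i) :\: nb E v| <= core_slack p &
    forall i v, i != i0 -> v \in C i ->
      part_bound p #|S| <= #|nn S E v| + core_slack p]].
Proof.
move=> st xS sparse hbig.
have [P [u [maxP covP uinj [[i0 ui0] rK uS uP]]]] :=
  base_clique p1 st xS sparse hbig.
exists (class S E u), (core chi S E P u), i0; split.
- exact: class_sub.
- exact: class_disjoint.
- split; first exact: (card_unclassed p1 st maxP covP uinj rK uS uP ui0).
  move=> i; rewrite (class_le st uS).
  exact: (class_ge p1 st maxP covP uinj rK uS uP ui0).
- by move=> j ji0; apply/subsetP=> v /classP[_ mv]; rewrite -ui0 mv eq_sym.
split.
- exact: core_sub.
- move=> i; exact: (class_core p1 st covP uinj rK).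
- move=> i v ii0; exact: (core_outer p1 st maxP covP uinj rK uS uP ui0 ii0).
move=> i v ii0 vi.
have := core_inner p1 st maxP covP uinj rK uP ui0 ii0 vi.
have := class_ge p1 st maxP covP uinj rK uS uP ui0 i.
have := cardsID (nb E v) (class S E u i).
have : #|class S E u i :\: nb E v| <= #|nn S E v|.
  by apply/subset_leq_card/setSD/class_sub.
rewrite /core_slack; clear; lia.
Qed.

(** The three terms count the vertices in no class, those in a class but not in its core, and those
    discarded from the class of [x]. *)
Definition near_slack :=
  class_slack p + p * (cover_slack p + clash_slack p) + 8 * p.+1 * p * core_slack p.

(** A fixed fraction of the part size: large enough that double counting discards boundedly many
    vertices, small enough that a transversal of the parts can still be chosen greedily. *)
Definition defect s := part_bound p s %/ (8 * p.+1).

(* The exchange says nothing on the class of [x] itself; there, vertices missing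
   many vertices of the other classes are discarded by double counting. *)
Lemma near_parts S E x : stuck chi p S E -> x \in S ->
  part_bound p #|S| <= #|nn S E x| + slack p ->
  8 * p.+1 * (core_slack p).+1 < part_bound p #|S| ->
  exists C : 'I_p -> {set T}, [/\
    forall i, C i \subset S /\ #|C i| <= part_bound p #|S|,
    forall i j v, v \in C i -> v \in C j -> i = j,
    #|S :\: \bigcup_i C i| <= near_slack,
    forall i j v, i != j -> v \in C i -> #|C j :\: nb E v| <= defect #|S| &
    forall i, exists y k, [/\ y \in S, k != i,
       part_bound p #|S| <= #|nn S E y| + core_slack p &
       forall j, j != k -> #|C j :\: nb E y| <= core_slack p]].
Proof.
move=> st xS sparse hbig; have [ES pE stS] := st.
have S0 : 0 < #|S| by apply/card_gt0P; exists x.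
have core_lt : core_slack p < part_bound p #|S| by nia.
have hbig' : p + cover_slack p + clash_slack p < part_bound p #|S|.
  by apply: leq_ltn_trans core_lt; rewrite /core_slack; clear; lia.
have core_defect : core_slack p <= defect #|S|.
  by rewrite /defect leq_divRL // mulnC; nia.
have [A [C [i0 [AS Adis [AW Age] Ax [CA CW Cout Cnn]]]]] := classes_exist st xS sparse hbig'.
pose Y := \bigcup_(j | j != i0) C j.
pose F i := if i == i0 then [set v in C i0 | #|Y :\: nb E v| <= defect #|S|] else C i.
have FC i : F i \subset C i.
  rewrite /F; case: eqP => [->|//]; by apply/subsetP=> v; rewrite inE => /andP[].
have FA i : F i \subset A i := subset_trans (FC i) (CA i).
exists F; split.
- move=> i; split; first exact: subset_trans (FA i) (AS i).
  by have /andP[Ai _] := Age i; apply: leq_trans (subset_leq_card (FA i)) Ai.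
- by move=> i j v vi vj; apply: (Adis i j v); apply: (subsetP (FA _)).
- pose bad := C i0 :\: F i0.
  have YS : Y \subset S.
    by apply/bigcupsP=> j _; apply: subset_trans (CA j) (AS j).
  have cbad : #|bad| <= 8 * p.+1 * p * core_slack p.
    suff le : #|bad| * (defect #|S|).+1 <= #|S| * core_slack p.
      have := part_bound_upper p1 #|S|.
      have := @ltn_ceil (part_bound p #|S|) (8 * p.+1) isT.
      rewrite -/(defect _); move: le; clear.
      move: (defect _) (part_bound _ _) (core_slack p) => d h c le h1 h2.
      rewrite -(leq_pmul2r (ltn0Sn d)); apply: leq_trans le _.
      apply: leq_trans (leq_mul h2 (leqnn c)) _.
      apply: leq_trans (leq_mul (leq_mul (leqnn p) (ltnW h1)) (leqnn c)) _.
      by apply: eq_leq; lia.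
    apply: (@leq_trans (\sum_(v in bad) #|Y :\: nb E v|)).
      rewrite -sum_nat_const; apply: leq_sum => v.
      rewrite /bad /F eqxx !inE ltnNge => /andP[+ vC].
      by rewrite vC.
    apply: (@leq_trans (\sum_(w in Y) #|A i0 :\: nb E w|)).
      have -> : \sum_(v in bad) #|Y :\: nb E v| =
          \sum_(v in bad) \sum_(w in Y | w \notin nb E v) 1.
        apply: eq_bigr => v _; rewrite -sum1_card; apply: eq_bigl => w.
        by rewrite in_setD andbC.
      rewrite (exchange_big_dep [in Y]) /=; last by move=> v w _ /andP[].
      apply: leq_sum => w wY; rewrite sum1_card; apply/subset_leq_card/subsetP=> v.
      rewrite unfold_in => /andP[/setDP[vC _] /andP[_ vw]].
      by rewrite in_setD nbC vw (subsetP (CA i0)).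
    apply: (@leq_trans (#|Y| * core_slack p)); last first.
      by rewrite leq_mul2r subset_leq_card ?orbT.
    rewrite -sum_nat_const; apply: leq_sum => w /bigcupP[j ji0 wj].
    apply: leq_trans (Cout j w ji0 wj); apply/subset_leq_card/setSD.
    apply/subsetP=> v vi; rewrite in_setD (subsetP (AS i0) v vi) andbT.
    by apply/negP=> vj; case/eqP: ji0; apply: Adis vj vi.
  have sub : S :\: \bigcup_i F i \subset
      (S :\: \bigcup_i A i) :|: (\bigcup_(i in [set: 'I_p]) (A i :\: C i) :|: bad).
    apply/subsetP=> v /setDP[vS vF]; rewrite in_setU in_setD vS andbT in_setU.
    have [/bigcupP[i _ vA]|//] /= := boolP (v \in \bigcup_i A i).
    have vFi : v \notin F i by apply: contra vF => vFi; apply/bigcupP; exists i.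
    have [vC|vC] := boolP (v \in C i); last first.
      by apply/orP; left; apply/bigcupP; exists i; rewrite ?inE ?vC ?vA.
    apply/orP; right; move: vFi; rewrite /bad in_setD /F.
    by case: eqP => [<-|_]; [rewrite eqxx vC andbT | rewrite vC].
  apply: leq_trans (subset_leq_card sub) _; rewrite /near_slack -addnA.
  apply: leq_trans (leq_card_setU _ _) (leq_add AW _).
  apply: leq_trans (leq_card_setU _ _) (leq_add _ cbad).
  have -> : p * (cover_slack p + clash_slack p) =
      #|[set: 'I_p]| * (cover_slack p + clash_slack p) by rewrite cardsT card_ord.
  by apply: card_bigcup_le => i _.
- move=> i j v ij vi; case: (eqVneq i i0) => [ii0|ii0].
    move: vi; rewrite /F ii0 eqxx inE => /andP[_]; apply: leq_trans.
    apply/subset_leq_card/setSD; rewrite -ii0 eq_sym (negPf ij).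
    by apply: bigcup_sup; rewrite -ii0 eq_sym.
  apply: leq_trans core_defect; apply: leq_trans (Cout i v ii0 (subsetP (FC i) v vi)).
  apply/subset_leq_card/setSD/subsetP=> w wj.
  have wA := subsetP (FA j) w wj; rewrite in_setD (subsetP (AS j)) // andbT.
  by apply/negP=> wi; case/eqP: ij; apply: Adis wi wA.
(* [x] is the base vertex for every part but its own; for the part of [x], any core vertex of
   another class serves. *)
move=> i; case: (eqVneq i i0) => [->|ii0]; last first.
  exists x, i0; split=> //; first by rewrite eq_sym.
    by apply: leq_trans sparse _; rewrite leq_add2l /core_slack /cover_slack; clear; nia.
  move=> j ji0; suff -> : F j :\: nb E x = set0 by rewrite cards0.
  by apply/eqP; rewrite setD_eq0; apply: subset_trans (FA j) (Ax j ji0).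
have [i1 i1i0] : exists i1 : 'I_p, i1 != i0.
  have /card_gt0P[i1] : 0 < #|[set~ i0]| by rewrite cardsC1 card_ord; lia.
  by rewrite !inE => i1i0; exists i1.
have /card_gt0P[y yC] : 0 < #|C i1|.
  have /andP[_] := Age i1; have := CW i1; have := cardsID (C i1) (A i1).
  have := subset_leq_card (subsetIr (A i1) (C i1)).
  by move: core_lt; rewrite /core_slack; clear; lia.
exists y, i1; split=> //.
- exact: subsetP (AS i1) y (subsetP (CA i1) y yC).
- exact: Cnn yC.
move=> j ji1; apply: leq_trans (Cout i1 y i1i0 yC).
apply/subset_leq_card/setSD/subsetP=> w wj.
have wA := subsetP (FA j) w wj; rewrite in_setD (subsetP (AS j)) // andbT.
by apply/negP=> wi; case/eqP: ji1; apply: Adis wA wi.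
Qed.

(* A leftover edge inside part [i] would extend a maximum star at [y], as [y]
   is adjacent to almost all of the part. *)
Lemma independent_part S E (C : 'I_p -> {set T}) i : stuck chi p S E ->
  (forall i, C i \subset S) ->
  (forall i j v, v \in C i -> v \in C j -> i = j) ->
  #|S :\: \bigcup_i C i| <= near_slack ->
  (forall i j v, i != j -> v \in C i -> #|C j :\: nb E v| <= defect #|S|) ->
  (exists y k, [/\ y \in S, k != i,
       part_bound p #|S| <= #|nn S E y| + core_slack p &
       forall j, j != k -> #|C j :\: nb E y| <= core_slack p]) ->
  (forall j, part_bound p #|S| <= #|C j| + near_slack + p) ->
  4 * ((p + 2) * core_slack p + near_slack + p + clash_slack p) <
    part_bound p #|S| ->
  exists2 A : {set T}, A \subset C i /\ #|C i :\: A| <= p.+2 * core_slack p &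
    forall u v, u \in A -> v \in A -> v \notin nb E u.
Proof.
move=> st CS Cdis CW Cmiss [y [k [yS ki nny Cy]]] Cge hbig.
have [ES pE stS] := st.
have [P maxP] := maxpacking_exists (star0 chi p E y).
have [starP _] := maxP; have kP := stS _ _ yS starP.
have [packP _] := star_packingP _ _ _ _ _ starP.
have covP : #|cover P| <= p.+1 * core_slack p.
  apply: leq_trans (card_cover_le packP) _; rewrite mulnC leq_pmul2l //.
  have : #|P| <= #|P| * p.-1 by apply: leq_pmulr; lia.
  by move: kP nny; clear; lia.
exists ((C i :&: nb E y) :\: cover P).
  split; first by apply: subset_trans (subsetDl _ _) (subsetIl _ _).
  have sub : C i :\: ((C i :&: nb E y) :\: cover P) \subset
      (C i :\: nb E y) :|: cover P.
    apply/subsetP=> v; rewrite in_setU !in_setD in_setI negb_and negbK.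
    by case: (v \in C i); case: (v \in cover P); case: (v \in nb E y).
  apply: leq_trans (subset_leq_card sub) _; rewrite mulSn.
  apply: leq_trans (leq_card_setU _ _) (leq_add (Cy i _) covP).
  by rewrite eq_sym.
move=> u v /setDP[/setIP[uC yu] uP] /setDP[/setIP[vC yv] vP].
apply/negP=> uv; have rQ := rclique3 pE yu yv uv.
have neq a : a \in nb E y -> a != y by rewrite in_nb eq_sym => /andP[].
have cQ : #|y |: [set u; v]| = 3.
  rewrite cardsU1 cards2 !inE !(eq_sym y) (negPf (neq _ yu)) (negPf (neq _ yv)).
  by move: uv; rewrite in_nb => /andP[->].
(* The triangle uses part [i] twice and [y] stands for part [k], so one vertex from each of the
   other [p - 2] parts completes it to [p.+1] vertices. *)
pose J := ~: [set i; k].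
have cJ : #|J| = p - 2 by rewrite cardsCs setCK card_ord cards2 eq_sym ki.
pose X j := (C j :&: nb E y :&: nb E u :&: nb E v) :\: cover P.
have inX j w : w \in X j ->
    [/\ w \in C j, w \in nb E y, w \in nb E u, w \in nb E v & w \notin cover P].
  by case/setDP=> /setIP[/setIP[/setIP[]]].
have inJ j : j \in J -> j != i /\ j != k.
  by rewrite in_setC in_set2 negb_or => /andP[].
have [||j j' w jJ j'J jj' /inX[wC _ _ _ _]|j /inJ[ji jk]|Q' [rQ' QQ' cQ' memQ']] :=
    @extend_transversal _ E (defect #|S|) p.+1 _ J X pE rQ.
- by rewrite cQ cJ; move: p1; clear; lia.
- move=> j w jJ /inX[_ yw uw vw _]; apply/subsetP=> a.
  by rewrite nbC !inE -!in_nb => /or3P[] /eqP->.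
- apply: leq_trans (Cmiss j j' w jj' wC); apply/subset_leq_card/setSD.
  by apply/subsetP=> a /inX[].
- have sub : C j \subset X j :|: ((C j :\: nb E y) :|:
      ((C j :\: nb E u) :|: ((C j :\: nb E v) :|: cover P))).
    apply/subsetP=> a aC; rewrite !in_setU !in_setD !in_setI aC !andbT.
    by case: (_ \in cover P); case: (_ \in nb E y); case: (_ \in nb E u);
       case: (_ \in nb E v).
  have cX : #|C j| <= #|X j| + (core_slack p + (defect #|S| + (defect #|S| + p.+1 * core_slack p))).
    apply: leq_trans (subset_leq_card sub) _.
    have := Cy j jk; have := Cmiss i j u; have := Cmiss i j v.
    rewrite eq_sym => /(_ ji vC) mv /(_ ji uC) mu my.
    apply: leq_trans (leq_card_setU _ _) (leq_add (leqnn _) _).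
    apply: leq_trans (leq_card_setU _ _) (leq_add my _).
    apply: leq_trans (leq_card_setU _ _) (leq_add mu _).
    exact: leq_trans (leq_card_setU _ _) (leq_add mv covP).
  have hd : 8 * p.+1 * defect #|S| <= part_bound p #|S|.
    by rewrite mulnC leq_divM.
  rewrite cJ -/(clash_slack p).
  move: cX hd hbig (Cge j) p1; clear.
  move: (defect _) (part_bound _ _) (core_slack p) (clash_slack p) near_slack.
  move=> d h c R B; case: (p) => [|[|q]] //.
  by rewrite !subSS subn0; nia.
apply: (maxstar_blocks p1 maxP _ _ rQ').
- by apply: (subsetP QQ'); rewrite setU11.
- by rewrite cQ' cQ cJ; move: p1; clear; lia.
move=> w /memQ'[|[j _ /inX[]]] //.
by rewrite !inE => /or3P[] /eqP-> //; rewrite eqxx.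
Qed.

Definition outside := near_slack + p * (p.+2 * core_slack p).

Definition threshold := 8 * p.+1 * (near_slack + core_slack p).+1 +
  4 * ((p + 2) * core_slack p + near_slack + p + clash_slack p).

Lemma independent_parts S E x : stuck chi p S E -> x \in S ->
  part_bound p #|S| <= #|nn S E x| + slack p ->
  threshold < part_bound p #|S| ->
  exists A : 'I_p -> {set T}, [/\ forall i, A i \subset S,
    forall i j v, v \in A i -> v \in A j -> i = j,
    #|S :\: \bigcup_i A i| <= outside,
    forall i u v, u \in A i -> v \in A i -> v \notin nb E u &
    forall i, #|A i| <= part_bound p #|S|].
Proof.
move=> st xS sparse hbig.
have S0 : 0 < #|S| by apply/card_gt0P; exists x.
have [|C [CS Cdis CW Cmiss Cbase]] := near_parts st xS sparse.
  by apply: leq_ltn_trans hbig; rewrite /threshold mulnS mulnS mulnDr; clear; lia.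
have Cge j : part_bound p #|S| <= #|C j| + near_slack + p.
  by apply: class_lower CW => // i; have [] := CS i.
have hbig2 : 4 * ((p + 2) * core_slack p + near_slack + p + clash_slack p) <
    part_bound p #|S|.
  by apply: leq_ltn_trans hbig; rewrite /threshold; clear; lia.
have CS' i : C i \subset S by have [] := CS i.
have /fin_all_exists2[A AC Aind] := fun i =>
  independent_part st CS' Cdis CW Cmiss (Cbase i) Cge hbig2.
have AsubC i : A i \subset C i by have [] := AC i.
exists A; split=> //.
- by move=> i; apply: subset_trans (AsubC i) (CS' i).
- by move=> i j v vi vj; apply: (Cdis i j v); apply: (subsetP (AsubC _)).
- have sub : S :\: \bigcup_i A i \subset
      (S :\: \bigcup_i C i) :|: \bigcup_(i in [set: 'I_p]) (C i :\: A i).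
    apply/subsetP=> v /setDP[vS vA]; rewrite in_setU in_setD vS andbT.
    have [/bigcupP[i _ vC]|//] /= := boolP (v \in \bigcup_i C i).
    apply/bigcupP; exists i; rewrite ?inE ?vC ?andbT //.
    by apply: contra vA => vA; apply/bigcupP; exists i.
  apply: leq_trans (subset_leq_card sub) _; rewrite /outside.
  apply: leq_trans (leq_card_setU _ _) (leq_add CW _).
  rewrite -[X in _ <= X * _]card_ord -cardsT.
  by apply: card_bigcup_le => i _; have [] := AC i.
by move=> i; have [_] := CS i; apply: leq_trans; apply: subset_leq_card.
Qed.
End Parts.

(** * Complete multipartite graphs *)

Section Count.
Variables (T : finType) (p : nat).
Hypothesis p0 : 0 < p.
Implicit Types (S : {set T}) (f : T -> 'I_p).

Definition part f S i : {set T} := [set v in S | f v == i].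
Definition inner f S : {set {set T}} := \bigcup_i pairs (part f S i).
Definition cross f S : {set {set T}} := pairs S :\: inner f S.

Lemma mem_inner f S u v : ([set u; v] \in inner f S) =
  [&& u \in S, v \in S, u != v & f u == f v].
Proof.
apply/bigcupP/and4P => [[i _]|[uS vS uv /eqP fuv]].
  rewrite mem_pairs2 !inE => /and3P[/andP[-> /eqP->] /andP[-> /eqP->] ->].
  by rewrite eqxx.
by exists (f u); rewrite // mem_pairs2 !inE uS vS uv fuv eqxx.
Qed.

Lemma mem_cross f S u v : ([set u; v] \in cross f S) =
  [&& u \in S, v \in S & f u != f v].
Proof.
rewrite in_setD mem_inner mem_pairs2.
case: (u \in S); case: (v \in S); rewrite //= ?andbF //.
by case: eqVneq => [->|]; rewrite ?eqxx //= andbT.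
Qed.

Lemma inner_sub f S : inner f S \subset pairs S.
Proof.
by apply/bigcupsP=> i _; apply: pairsS; apply/subsetP=> v; rewrite inE => /andP[].
Qed.

Lemma card_cross f S : #|cross f S| + #|inner f S| = 'C(#|S|, 2).
Proof.
by rewrite -card_pairs -(cardsID (inner f S) (pairs S)) (setIidPr (inner_sub f S)) addnC.
Qed.

Lemma card_inner f S : #|inner f S| = \sum_i 'C(#|part f S i|, 2).
Proof.
rewrite /inner (eq_bigl [in [set: 'I_p]]) => [|i]; last by rewrite inE.
rewrite card_bigcup_disjoint => [|i j _ _ ij]; last first.
  rewrite -setI_eq0 pairsI; apply/eqP/setP=> e; rewrite inE in_set0.
  apply/andP=> -[/subsetP sub /eqP ce].
  have /card_gt0P[v /sub] : 0 < #|e| by rewrite ce.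
  by rewrite !inE => /andP[/andP[_ /eqP->] /andP[_]]; rewrite (negPf ij).
rewrite (eq_bigl predT) => [|i]; last by rewrite inE.
by apply: eq_bigr => i _; rewrite card_pairs.
Qed.

Lemma sum_part f S : \sum_i #|part f S i| = #|S|.
Proof.
rewrite -[RHS]sum1_card (partition_big f predT) //=; apply: eq_bigr => i _.
by rewrite -sum1_card; apply: eq_bigl => v; rewrite inE.
Qed.

(** The case [m = p] is included so that the induction can pass from [q] to [q.+1]. *)
Lemma inner_pairs_closed q m : m <= p ->
  inner_pairs p (p * q + m) = p * 'C(q, 2) + m * q.
Proof.
elim: q m => [|q IHq] m; last first.
  elim: m => [_|m IHm mp].
    by rewrite mulnS addn0 addnC IHq // binS bin1 mulnDr mul0n addn0.
  rewrite addnS inner_pairsS IHm 1?ltnW // [p * q.+1]mulnC divnMDl // divn_small //.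
  by rewrite addn0 -addnA mulSnr.
elim: m => [_|m IHm mp]; first by rewrite muln0 /inner_pairs big_ord0 muln0.
by rewrite addnS inner_pairsS IHm 1?ltnW // muln0 divn_small // !muln0.
Qed.

Lemma double_bin2 n : 2 * 'C(n, 2) + n = n * n.
Proof. by elim: n => // n IH; rewrite binS bin1; nia. Qed.

(** The linear function ['C(q, 2) + (a - q) * q] of [a] is the chord of ['C(a, 2)] through [q] and
    [q.+1]; by convexity it lies below at all integers and touches only at these two. *)
Lemma bin2_tangent q a :
  'C(q, 2) + a * q <= 'C(a, 2) + q * q ?= iff ((a == q) || (a == q.+1)).
Proof.
have := double_bin2 q; have := double_bin2 a.
move: 'C(q, 2) 'C(a, 2) => x y ha hq; split.
  by have [le|lt] := leqP a q; nia.
apply/eqP/orP => [e|[/eqP ea|/eqP ea]]; last 2 first.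
- by rewrite ea in ha *; nia.
- by rewrite ea in ha *; nia.
have [le|lt] := leqP a q; first by left; apply/eqP; nia.
by right; apply/eqP; nia.
Qed.

(** Summing the chord bound at [q = #|S| %/ p] makes the linear side depend only on [#|S|]; equality
    holds term by term, that is, for balanced parts. *)
Lemma inner_pairs_le f S : inner_pairs p #|S| <= #|inner f S| ?= iff
  [forall i, (#|part f S i| == #|S| %/ p) || (#|part f S i| == (#|S| %/ p).+1)].
Proof.
set q := #|S| %/ p; set m := #|S| %% p.
have mp : m <= p by rewrite ltnW // ltn_pmod.
have nE : #|S| = p * q + m by rewrite mulnC -divn_eq.
have sumE : \sum_i ('C(q, 2) + #|part f S i| * q) = inner_pairs p #|S| + p * (q * q).
  rewrite big_split /= sum_nat_const card_ord -big_distrl /= sum_part.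
  by rewrite {2}nE inner_pairs_closed //= {1}nE; lia.
have sumE' : \sum_(i < p) ('C(#|part f S i|, 2) + q * q) = #|inner f S| + p * (q * q).
  by rewrite big_split /= sum_nat_const card_ord card_inner.
have := leqif_sum (fun (i : 'I_p) (_ : true) => bin2_tangent q #|part f S i|).
rewrite sumE sumE' => -[le eq]; split; first by rewrite leq_add2r in le.
by rewrite -eq eqn_add2r.
Qed.
End Count.

(** * Rigidity *)

Section Rigidity.
Variables (T : finType) (chi : {set T} -> nat) (p : nat).
Hypothesis p1 : 1 < p.
Implicit Types (E : {set {set T}}) (Q S X : {set T}) (P : {set {set T}}).
Implicit Types (u v w x y z : T).

Let p0 : 0 < p := ltnW p1.

(** For every [f] the crossing edges alone do not exceed the Turán number, so the excess and the
    cost of [P] are paid by inner edges. The cost [('C(p.+1, 2)).-1] is rounded down to 2: any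
    factor above 1 beats one clique per inner edge. *)
Lemma excess_inner S E g (f : T -> 'I_p) P : excess chi p S E g ->
  packing chi p E P -> g + 2 * #|P| <= #|E :&: inner f S|.
Proof.
move=> [ES exc] packP; have := exc P packP.
have c2 : 2 * #|P| <= ('C(p.+1, 2)).-1 * #|P|.
  rewrite leq_mul2r binS bin1; case: #|P| => //= _.
  by have : 0 < 'C(p, 2); [rewrite bin_gt0 | move: p1; clear; lia].
have [inn _] := inner_pairs_le p0 f S; have := card_cross f S.
have := cardsID (inner f S) E.
have : #|E :\: inner f S| <= #|cross f S| by apply/subset_leq_card/setSD.
move: c2 inn; move: (_ * #|P|) ('C(#|S|, 2)) (inner_pairs _ _).
by clear; lia.
Qed.

Section Frame.
Variables (S : {set T}) (E : {set {set T}}) (A : 'I_p -> {set T}) (f : T -> 'I_p).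
Let W := S :\: \bigcup_i A i.
Let h := part_bound p #|S|.

Definition inner_degree w := #|A (f w) :&: nb E w|.

Hypothesis st : stuck chi p S E.
Hypothesis AS : forall i, A i \subset S.
Hypothesis Adis : forall i j v, v \in A i -> v \in A j -> i = j.
Hypothesis cW : #|W| <= outside p.
Hypothesis Aind : forall i u v, u \in A i -> v \in A i -> v \notin nb E u.
Hypothesis Ah : forall i, #|A i| <= h.
Hypothesis S0 : 0 < #|S|.
Hypothesis fA : forall i v, v \in A i -> f v = i.
Hypothesis fW : forall w i, w \in W -> inner_degree w <= #|A i :&: nb E w|.

Let ES : E \subset pairs S. Proof. by case: st. Qed.
Let pE : proper chi E. Proof. by case: st. Qed.

Lemma frame_lower i : h <= #|A i| + outside p + p.
Proof. exact: class_lower. Qed.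

Lemma frameP v : v \in S -> v \notin W -> exists i, v \in A i.
Proof.
by move=> vS; rewrite in_setD vS andbT negbK => /bigcupP[i _]; exists i.
Qed.

Lemma notinW i v : v \in A i -> v \notin W.
Proof. by move=> vA; rewrite in_setD negb_and negbK; apply/orP; left; apply/bigcupP; exists i. Qed.

Lemma split_nn (i : 'I_p) v (B : {set T}) : v \in S -> B \subset S ->
  [disjoint A i & B] -> #|A i :\: nb E v| + #|B :\: nb E v| <= h.
Proof.
move=> vS BS dis; apply: leq_trans (stuck_nn st vS).
rewrite -(cardsUI (A i :\: nb E v)).
have -> : (A i :\: nb E v) :&: (B :\: nb E v) = set0.
  apply/setP=> w; rewrite in_set0; apply/negP=> /setIP[/setDP[wA _] /setDP[wB _]].
  by move: dis; rewrite -setI_eq0 => /eqP/setP/(_ w); rewrite in_set0 in_setI wA wB.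
rewrite cards0 addn0; apply/subset_leq_card/subsetP=> w.
by case/setUP=> /setDP[wB wv]; rewrite in_setD wv; [apply: (subsetP (AS i)) | apply: (subsetP BS)].
Qed.

Lemma A_disjoint i j : i != j -> [disjoint A i & A j].
Proof.
move=> ij; rewrite -setI_eq0; apply/eqP/setP=> v; rewrite in_set0.
by apply/negP=> /setIP[vi vj]; case/eqP: ij; apply: Adis vi vj.
Qed.

(** By independence [v] misses all of [A i], which nearly exhausts the [h] vertices it may miss. *)
Lemma frame_miss i j v : v \in A i -> i != j ->
  #|A j :\: nb E v| <= outside p + p.
Proof.
move=> vA ij; have vS := subsetP (AS i) v vA.
have := split_nn vS (AS j) (A_disjoint ij); have := frame_lower i.
have -> : A i :\: nb E v = A i; last by clear; lia.
apply/setP=> w; rewrite in_setD; case: (boolP (w \in A i)) => wA; last by rewrite andbF.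
by rewrite (Aind vA wA).
Qed.

Lemma transversal_le1 Q i : rclique chi E Q -> #|A i :&: Q| <= 1.
Proof.
move=> rQ; rewrite leqNgt; apply/card_gt1P=> -[u [v [/setIP[uA uQ] /setIP[vA vQ] uv]]].
by have := Aind uA vA; rewrite (rclique_nb rQ).
Qed.

Definition hub_slack := p * (outside p + p + outside p * p.+1) + clash_slack p.

Definition hub_packing P := packing chi p E P && [forall Q in P, #|Q :&: W| == 1].

(** A hub clique through [v] is determined by its vertex in [W], as two cliques of a packing never
    share two vertices. So [v] loses few edges even when [P] is large. *)
Lemma hub_count P v : hub_packing P -> v \notin W ->
  #|[set Q in P | v \in Q]| <= #|W|.
Proof.
move=> /andP[packP /forall_inP hub] vW; rewrite -[X in _ <= X]muln1.
have [PQ dis] := packingP _ _ _ _ packP.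
apply: (@leq_trans #|\bigcup_(w in W) [set Q in P | (v \in Q) && (w \in Q)]|).
  apply/subset_leq_card/subsetP=> Q; rewrite inE => /andP[QP vQ].
  have /card_gt0P[w /setIP[wQ wW]] : 0 < #|Q :&: W| by rewrite (eqP (hub Q QP)).
  by apply/bigcupP; exists w; rewrite // inE QP vQ.
apply: card_bigcup_le => w wW; rewrite leqNgt; apply/card_gt1P=> -[Q [Q' []]].
rewrite !inE => /and3P[QP vQ wQ] /and3P[Q'P vQ' wQ'] /eqP; apply.
by apply: (dis Q Q' v w) => //; apply: contraNneq vW => ->.
Qed.

(* Otherwise [w] and fresh vertices, one in each part, form one more clique. *)
Lemma hub_degree P w : maxpacking hub_packing P -> w \in W ->
  inner_degree w <= #|[set Q in P | w \in Q]| + hub_slack.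
Proof.
move=> [hubP maxP] wW; rewrite leqNgt; apply/negP=> big.
have [packP hub] := andP hubP; have [PQ dis] := packingP _ _ _ _ packP.
set Pw := [set Q in P | w \in Q] in big.
(* The size of [P] is not bounded yet, so its edges rather than its vertices are removed; only the
   vertices of cliques through [w] are avoided altogether. *)
pose E' := E :\: span P.
have E'E : E' \subset E by apply: subsetDl.
have pE' := properS E'E pE.
pose X j := (A j :&: nb E w) :\: cover Pw.
have [|j v _ /setDP[/setIP[vA wv] vP]|j j' v _ _ jj' /setDP[/setIP[vA wv] vP]
    |j _|Q [rQ wQ cQ QX]] :=
  @extend_transversal _ chi _ E' (outside p + p + outside p * p.+1) p.+1 [set w]
    [set: 'I_p] X pE' (rclique1 _ _ _).
- by rewrite cards1 cardsT card_ord.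
- rewrite sub1set nbC in_nb; move: (wv); rewrite in_nb => /andP[nwv wvE].
  rewrite nwv in_setD wvE andbT; apply/spanP=> -[Q QP].
  rewrite mem_pairs2 => /and3P[wQ vQ _]; case/bigcupP: vP; exists Q => //.
  by rewrite inE QP.
- pose Pv := [set Q in P | v \in Q].
  have cPv : #|cover Pv| <= outside p * p.+1.
    apply: (@leq_trans (#|Pv| * p.+1)).
      by apply: card_bigcup_le => Q; rewrite inE => /andP[/PQ[->]].
    rewrite leq_mul2r /=; apply: leq_trans cW; apply: hub_count => //.
    exact: notinW vA.
  have sub : X j' :\: nb E' v \subset (A j' :\: nb E v) :|: cover Pv.
    apply/subsetP=> y /setDP[/setDP[/setIP[yA _] _] yv].
    rewrite in_setU in_setD yA andbT; case: (boolP (y \in nb E v)) => //= vy.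
    move: yv; move: (vy); rewrite !in_nb => /andP[nvy vyE].
    rewrite nvy in_setD vyE andbT negbK => /spanP[Q QP].
    rewrite mem_pairs2 => /and3P[vQ yQ _].
    by apply/bigcupP; exists Q; rewrite // inE QP.
  apply: leq_trans (subset_leq_card sub) _.
  by apply: leq_trans (leq_card_setU _ _) (leq_add (frame_miss vA jj') cPv).
- have cP : #|A j :&: cover Pw| <= #|Pw|.
    have -> : A j :&: cover Pw = \bigcup_(Q in Pw) (A j :&: Q).
      apply/setP=> y; apply/setIP/bigcupP => [[yA /bigcupP[Q QP yQ]]|[Q QP /setIP[yA yQ]]].
        by exists Q; rewrite // in_setI yA.
      by split=> //; apply/bigcupP; exists Q.
    rewrite -[X in _ <= X]muln1; apply: card_bigcup_le => Q.
    by rewrite inE => /andP[/PQ[_ rQ] _]; apply: transversal_le1.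
  have : #|A j :&: nb E w| <= #|X j| + #|A j :&: cover Pw|.
    rewrite -(cardsID (cover Pw) (A j :&: nb E w)) addnC leq_add2l.
    by apply/subset_leq_card/setSI/subsetIl.
  rewrite cardsT card_ord -/(clash_slack p).
  have := fW j wW; move: big cP; rewrite /hub_slack; clear; lia.
rewrite sub1set in wQ; rewrite cards1 cardsT card_ord add1n in cQ.
have QW : Q :&: W = [set w].
  apply/setP=> y; rewrite in_setI in_set1; apply/andP/eqP => [[yQ yW]|->]; last by [].
  have [|[j _ /setDP[/setIP[yA _] _]]] := QX y yQ; first by rewrite inE => /eqP.
  by rewrite (negPf (notinW yA)) in yW.
have disQ Q' u v : Q' \in P -> u \in Q -> u \in Q' -> v \in Q -> v \in Q' -> u = v.
  move=> Q'P uQ uQ' vQ vQ'; apply/eqP/negPn/negP=> uv.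
  have /andP[/subsetP/(_ [set u; v])] := rQ.
  rewrite mem_pairs2 uQ vQ uv => /(_ isT) /setDP[_] /spanP[].
  by exists Q'; rewrite // mem_pairs2 uQ' vQ' uv.
have := packing_notin p0 cQ disQ => QnP.
suff /maxP : hub_packing (Q |: P) by rewrite cardsU1 QnP add1n ltnn.
apply/andP; split; first by apply: packingU1 disQ => //; apply: rcliqueS rQ.
by apply/forall_inP=> Q' /setU1P[->|/(forall_inP hub)//]; rewrite QW cards1.
Qed.

Lemma inner_edges_le :
  #|E :&: inner f S| <= \sum_(w in W) inner_degree w + #|W| * #|W|.
Proof.
pose F w := [set [set w; v] | v in (A (f w) :&: nb E w) :|: W].
apply: (@leq_trans #|\bigcup_(w in W) F w|).
  apply/subset_leq_card/subsetP=> e /setIP[eE eI].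
  have /pairsP[u [v [uS vS uv def_e]]] := subsetP ES e eE.
  rewrite def_e in eE eI *; move: eI; rewrite mem_inner => /and4P[_ _ _ /eqP fuv].
  have caseW a b : a \in W -> b \in S -> f a = f b -> [set a; b] \in E -> a != b ->
      [set a; b] \in \bigcup_(w in W) F w.
    move=> aW bS fab abE ab; apply/bigcupP; exists a => //; apply: imset_f.
    rewrite in_setU; case: (boolP (b \in W)) => [_|/(frameP bS)[i bA]]; first by rewrite orbT.
    by rewrite in_setI fab (fA bA) bA in_nb ab abE.
  have [uW|/(frameP uS)[i uA]] := boolP (u \in W); first exact: caseW.
  have [vW|/(frameP vS)[j vA]] := boolP (v \in W).
    by rewrite setUC; apply: caseW => //; rewrite 1?setUC // eq_sym.
  have ij : i = j by rewrite -(fA uA) fuv (fA vA).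
  by rewrite -ij in vA; have := Aind uA vA; rewrite in_nb uv eE.
rewrite -sum_nat_const -big_split /=.
apply: (@leq_trans (\sum_(w in W) #|F w|)).
  elim/big_rec2: _ => [|i m B _ le]; first by rewrite cards0.
  by apply: leq_trans (leq_card_setU _ _) _; rewrite leq_add2l.
apply: leq_sum => w wW; apply: leq_trans (leq_imset_card _ _) _.
by apply: leq_trans (leq_card_setU _ _) _.
Qed.

Definition degree_slack := 2 * (outside p * hub_slack) + outside p * outside p.

(** Let [d] be the sum. A maximum hub packing has at least [d - #|W| * hub_slack] cliques, since
    each meets [W] once; yet twice their number is at most the number of inner edges, hence at most
    [d + #|W| * #|W|]. The factor 2 against 1 bounds [d]. *)
Lemma sum_inner_degree g : excess chi p S E g ->
  \sum_(w in W) inner_degree w <= degree_slack.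
Proof.
move=> exc.
have [|P maxP] := @maxpacking_exists T hub_packing.
  by rewrite /hub_packing packing0; apply/forall_inP=> Q; rewrite inE.
have [hubP _] := maxP; have [packP /forall_inP hub] := andP hubP.
have sumP : \sum_(w in W) #|[set Q in P | w \in Q]| = #|P|.
  have -> : \sum_(w in W) #|[set Q in P | w \in Q]| =
      \sum_(w in W) \sum_(Q in P | w \in Q) 1.
    by apply: eq_bigr => w _; rewrite -sum1_card; apply: eq_bigl => Q; rewrite inE.
  rewrite (exchange_big_dep [in P]) /=; last by move=> w Q _ /andP[].
  rewrite -[RHS]sum1_card; apply: eq_bigr => Q QP.
  rewrite sum1_card -[RHS](eqP (hub Q QP)); apply: eq_card => w.
  by rewrite unfold_in QP in_setI andbC.
have le : \sum_(w in W) inner_degree w <= #|P| + #|W| * hub_slack.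
  rewrite -sumP -sum_nat_const -big_split /=; apply: leq_sum => w wW.
  exact: hub_degree.
have := excess_inner f exc packP; have := inner_edges_le.
have WW : #|W| * #|W| <= outside p * outside p by apply: leq_mul.
have Wh : #|W| * hub_slack <= outside p * hub_slack by apply: leq_mul.
move: le WW Wh; rewrite /degree_slack; clear.
move: (\sum_(_ in _) _) #|P| (#|W| * _) (_ * hub_slack) #|E :&: _|; lia.
Qed.

Definition inner_slack := degree_slack + outside p * outside p.
Definition vertex_slack := outside p + p + degree_slack.
Definition cover_threshold :=
  4 * vertex_slack + p.+1 * inner_slack + p * (outside p + p) + clash_slack p.

(** With its inner degree bounded, an exceptional vertex also misses nearly all of its own part, and
    therefore little of any other. *)
Lemma vertex_miss g j z : excess chi p S E g -> z \in S -> j != f z ->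
  #|A j :\: nb E z| <= vertex_slack.
Proof.
move=> exc zS jf; have [zW|/(frameP zS)[i zA]] := boolP (z \in W); last first.
  apply: leq_trans (frame_miss zA _) (leq_addr _ _).
  by rewrite eq_sym -(fA zA).
have := split_nn zS (AS j) (A_disjoint (_ : f z != j)); rewrite eq_sym => /(_ jf).
have := frame_lower (f z); have := cardsID (nb E z) (A (f z)).
have := sum_inner_degree exc; rewrite (bigD1 z) //= /inner_degree.
rewrite /vertex_slack; clear; move: (\sum_(_ in _ | _) _); lia.
Qed.

(* If such a packing covers all inner edges, it has at least as many cliques as
   there are inner edges, contradicting [excess_inner] unless there are none. *)
Definition sparse_packing P :=
  packing chi p E P && [forall Q in P, #|pairs Q :&: inner f S| <= 1].

(** The inner edges, and with them [P], are now bounded in number, so the vertices of [P] can be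
    avoided. An uncovered inner edge would extend by a fresh vertex from each other part to a clique
    with no further inner edge, which could be added to [P]. *)
Lemma inner_covered g P (e : {set T}) : excess chi p S E g ->
  cover_threshold < h -> maxpacking sparse_packing P ->
  e \in E :&: inner f S -> e \in span P.
Proof.
move=> exc hbig [sparP maxP] /setIP[eE eI].
have [packP spar] := andP sparP; have [PQ dis] := packingP _ _ _ _ packP.
apply/negPn/negP=> eP.
have /pairsP[u [v [uS vS uv def_e]]] := subsetP ES e eE.
have fuv : f u = f v by move: eI; rewrite def_e mem_inner => /and4P[_ _ _ /eqP].
have vu : v \in nb E u by rewrite in_nb uv -def_e.
have cP : #|cover P| <= p.+1 * inner_slack.
  apply: leq_trans (card_cover_le packP) _; rewrite mulnC leq_mul2l /=.
  have WW : #|W| * #|W| <= outside p * outside p by apply: leq_mul.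
  have := excess_inner f exc packP; have := inner_edges_le.
  have := sum_inner_degree exc; move: WW; rewrite /inner_slack; clear.
  move: (\sum_(_ in _) _) (#|W| * #|W|) #|E :&: _| (outside p * _) => a b c d.
  by move: #|P| degree_slack; clear; lia.
pose J := [set~ f u].
have cJ : #|J| = p.-1 by rewrite cardsC1 card_ord.
pose X j := (A j :&: nb E u :&: nb E v) :\: cover P.
have inX j y : y \in X j -> [/\ y \in A j, y \in nb E u, y \in nb E v & y \notin cover P].
  by case/setDP=> /setIP[/setIP[]].
have cuv : #|[set u; v]| = 2 by rewrite cards2 uv.
have [|j y _ /inX[_ uy vy _]|j j' y _ _ jj' /inX[yA _ _ _]|j|Q [rQ uvQ cQ QX]] :=
  @extend_transversal _ chi _ E (outside p + p) p.+1 [set u; v] J X pE (rclique2 pE vu).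
- by rewrite cuv cJ; move: p0; clear; lia.
- by apply/subsetP=> a; rewrite nbC => /set2P[]->.
- apply: leq_trans (frame_miss yA jj'); apply/subset_leq_card/setSD.
  by apply/subsetP=> a /inX[].
- rewrite in_setC1 => jf.
  have sub : A j \subset X j :|: ((A j :\: nb E u) :|: ((A j :\: nb E v) :|: cover P)).
    apply/subsetP=> a aA; rewrite !in_setU !in_setD !in_setI aA !andbT.
    by case: (_ \in cover P); case: (_ \in nb E u); case: (_ \in nb E v).
  have cX : #|A j| <= #|X j| + (vertex_slack + (vertex_slack + p.+1 * inner_slack)).
    apply: leq_trans (subset_leq_card sub) _.
    have mu := vertex_miss exc uS jf.
    have mv : #|A j :\: nb E v| <= vertex_slack by apply: vertex_miss exc vS _; rewrite -fuv.
    apply: leq_trans (leq_card_setU _ _) (leq_add (leqnn _) _).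
    apply: leq_trans (leq_card_setU _ _) (leq_add mu _).
    exact: leq_trans (leq_card_setU _ _) (leq_add mv cP).
  have pp : p.-1 * (outside p + p) <= p * (outside p + p) by rewrite leq_mul2r leq_pred orbT.
  rewrite cJ -/(clash_slack p); move: cX pp hbig (frame_lower j).
  rewrite /cover_threshold /vertex_slack; clear.
  by move: (p.-1 * _) (p * _) (p.+1 * _) => a b c; lia.
have cQ1 : #|Q| = p.+1 by rewrite cQ cuv cJ; move: p0; clear; lia.
have inQ a : a \in Q -> a \in [set u; v] \/ exists2 j, j != f u & a \in A j /\ a \notin cover P.
  case/QX=> [|[j jJ /inX[aA _ _ aP]]]; first by left.
  by right; exists j; rewrite // -in_setC1.
have disQ Q' a b : Q' \in P -> a \in Q -> a \in Q' -> b \in Q -> b \in Q' -> a = b.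
  move=> Q'P aQ aQ' bQ bQ'; apply/eqP/negPn/negP=> ab; case/negP: eP.
  apply/spanP; exists Q' => //.
  have inuv c : c \in Q -> c \in Q' -> c \in [set u; v].
    move=> /inQ[//|[j _ [_ /bigcupP cP']]] cQ'; case: cP'; by exists Q'.
  have -> : e = [set a; b].
    rewrite def_e; apply/esym/eqP; rewrite eqEcard cuv cards2 ab andbT.
    by apply/subsetP=> c /set2P[]->; apply: inuv.
  by rewrite mem_pairs2 aQ' bQ' ab.
have QnP := packing_notin p0 cQ1 disQ.
suff /maxP : sparse_packing (Q |: P) by rewrite cardsU1 QnP add1n ltnn.
apply/andP; split; first exact: packingU1 disQ.
apply/forall_inP=> Q' /setU1P[->|/(forall_inP spar)//].
rewrite -(cards1 e); apply/subset_leq_card/subsetP=> e' /setIP[/pairsP[a [b [aQ bQ ab ->]]]].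
rewrite mem_inner in_set1 def_e => /and4P[_ _ _ /eqP fab].
have fuvE c : c \in [set u; v] -> f c = f u by case/set2P=> ->.
have [auv|[i iu [aA _]]] := inQ a aQ; have [buv|[j ju [bA _]]] := inQ b bQ.
- rewrite eqEcard cuv cards2 ab andbT; apply/subsetP=> c /set2P[]->//.
- by case/eqP: ju; rewrite -(fA bA) -fab fuvE.
- by case/eqP: iu; rewrite -(fA aA) fab fuvE.
have ij : i = j by rewrite -(fA aA) fab (fA bA).
by rewrite -ij in bA; have := Aind aA bA; rewrite (rclique_nb rQ).
Qed.

Lemma frame_rigid g : excess chi p S E g -> cover_threshold < h ->
  E = cross f S /\
  forall i, #|part f S i| = #|S| %/ p \/ #|part f S i| = (#|S| %/ p).+1.
Proof.
move=> exc hbig; have [_ exP] := exc.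
have [|P maxP] := @maxpacking_exists T sparse_packing.
  by rewrite /sparse_packing packing0; apply/forall_inP=> Q; rewrite inE.
have [sparP _] := maxP; have [packP /forall_inP spar] := andP sparP.
have le : #|E :&: inner f S| <= #|P|.
  apply: (@leq_trans #|\bigcup_(Q in P) (pairs Q :&: inner f S)|); last first.
    by rewrite -[X in _ <= X]muln1; apply: card_bigcup_le.
  apply/subset_leq_card/subsetP=> e eEI.
  have /spanP[Q QP eQ] := inner_covered exc hbig maxP eEI.
  by apply/bigcupP; exists Q; rewrite // in_setI eQ; have /setIP[] := eEI.
have lower := excess_inner f exc packP.
have EI0 : E :&: inner f S = set0.
  by apply/eqP; rewrite -cards_eq0; move: le lower; clear; lia.
have sub : E \subset cross f S.
  apply/subsetP=> e eE; rewrite in_setD (subsetP ES e eE) andbT.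
  by apply/negP=> eI; have := in_set0 e; rewrite -EI0 in_setI eE eI.
(* The empty packing gives at least as many edges as the Turán number, while the crossing edges are
   at most that many; equality yields both [E = cross f S] and balance. *)
have := exP set0 (packing0 _ _ _); rewrite cards0 muln0 addn0 => tight.
have [inn eqinn] := inner_pairs_le p0 f S; have cc := card_cross f S.
have cE := subset_leq_card sub.
split.
  by apply/eqP; rewrite eqEcard sub; move: tight inn cc cE; clear; lia.
move=> i; have /forallP/(_ i) : [forall i, (#|part f S i| == #|S| %/ p) ||
    (#|part f S i| == (#|S| %/ p).+1)].
  by rewrite -eqinn; apply/eqP; move: tight inn cc cE; clear; lia.
by case/orP=> /eqP; [left | right].
Qed.
End Frame.

(** An exceptional vertex joins a part in which it has fewest neighbours, so its inner degree is a
    lower bound for its degree into every part; hub cliques need this. *)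
Lemma frame_exists S E (A : 'I_p -> {set T}) :
  (forall i j v, v \in A i -> v \in A j -> i = j) ->
  exists f : T -> 'I_p, (forall i v, v \in A i -> f v = i) /\
    forall w i, w \in S :\: \bigcup_i A i ->
      #|A (f w) :&: nb E w| <= #|A i :&: nb E w|.
Proof.
move=> Adis.
suff /fin_all_exists2[f fA fW] : forall w, exists2 i : 'I_p,
    (forall j, w \in A j -> i = j) &
    (w \in S :\: \bigcup_i A i -> forall j, #|A i :&: nb E w| <= #|A j :&: nb E w|).
  by exists f; split=> [i v /fA|w i /fW].
move=> w; have [/bigcupP[i _ wA]|wA] := boolP (w \in \bigcup_i A i).
  exists i; first by move=> j; apply: Adis.
  by rewrite in_setD => /andP[/bigcupP[]]; exists i.
have i0 : 'I_p by exact: Ordinal p0.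
case: (@arg_minnP _ i0 xpredT (fun i => #|A i :&: nb E w|) isT) => i _ mini.
exists i; last by move=> _ j; apply: mini.
by move=> j wj; case/bigcupP: wA; exists j.
Qed.

Lemma stuck_turan S E g x : excess chi p S E g -> stuck chi p S E -> x \in S ->
  part_bound p #|S| <= #|nn S E x| + slack p ->
  threshold p + cover_threshold < part_bound p #|S| ->
  exists f : T -> 'I_p, E = cross f S /\
    forall i, #|part f S i| = #|S| %/ p \/ #|part f S i| = (#|S| %/ p).+1.
Proof.
move=> exc st xS sparse hbig.
have [|A [AS Adis cW Aind Ah]] := independent_parts p1 st xS sparse.
  by move: hbig; clear; lia.
have [f [fA fW]] := frame_exists S E Adis.
have S0 : 0 < #|S| by apply/card_gt0P; exists x.
exists f; apply: (frame_rigid st AS Adis cW Aind Ah S0 fA fW exc).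
by move: hbig; clear; lia.
Qed.
End Rigidity.

(** * Descent *)

Section Descent.
Variables (T : finType) (chi : {set T} -> nat) (p : nat).
Hypothesis p1 : 1 < p.
Implicit Types (E : {set {set T}}) (Q S X : {set T}) (P : {set {set T}}).

Definition turan_like S E : Prop := exists f : T -> 'I_p, E = cross f S /\
  forall i, #|part f S i| = #|S| %/ p \/ #|part f S i| = (#|S| %/ p).+1.

(** The 20 is required by [three_peels]; the product lifts [part_bound], which is at least
    [#|S| / p], above the thresholds. *)
Definition large_order := 20 + p * (threshold p + cover_threshold p).+1.

Lemma sparse_vertex_or_peels S E g : proper chi E -> excess chi p S E g ->
  stuck chi p S E -> 20 < #|S| ->
  (exists2 x, x \in S & part_bound p #|S| <= #|nn S E x| + slack p) \/
  exists S' E', [/\ E' \subset E, #|S| = #|S'| + 3 & excess chi p S' E' g.+1].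
Proof.
move=> pE exc st S20; have S0 : 0 < #|S| by apply: leq_ltn_trans S20.
have [p3|p3] := ltnP 2 p; first by left; apply: (stuck_sparse_vertex_gt2 p1 p3 st S0).
have p2 : p = 2 by apply/eqP; rewrite eqn_leq p3.
rewrite p2 in exc st *; have [sparse|nn2] := stuck_sparse_vertex_2 st S0.
  by left.
by right; apply: three_peels.
Qed.

Lemma peel_or_turan S E g : proper chi E -> excess chi p S E g ->
  large_order < #|S| ->
  (exists S' E', [/\ E' \subset E, #|S'| < #|S|, #|S| <= #|S'| + 3 &
     excess chi p S' E' g.+1]) \/ turan_like S E.
Proof.
move=> pE exc big; have [ES _] := exc.
have S20 : 20 < #|S| by apply: leq_ltn_trans big; apply: leq_addr.
have [/existsP[x /existsP[P /and3P[xS starP gain]]]|/existsPn no] :=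
  boolP [exists x, exists P, [&& x \in S, star chi p E x P &
    part_bound p #|S| < #|P| * p.-1 + #|nn S E x|]].
  left; exists (S :\ x), (peeled E x P); have := cardsD1 x S; rewrite xS => cS.
  split; [exact: peeled_sub|by rewrite cS|by rewrite cS addnC leq_add2l|].
  by apply: peel exc xS starP _; rewrite // addSn -addnS -addnA leq_add2l.
have st : stuck chi p S E.
  split=> // x P xS starP; rewrite leqNgt; apply/negP=> gain.
  by have /existsPn/(_ P) := no x; rewrite xS starP gain.
have [[x xS sparse]|[S' [E' [E'E cS exc']]]] := sparse_vertex_or_peels pE exc st S20.
  right; apply: stuck_turan exc st xS sparse _ => //.
  have := part_bound_upper p1 #|S|; move: big; rewrite /large_order.
  set t := threshold _ + _; set h := part_bound _ _ => big up.
  have : p * t.+1 < p * h by apply: leq_trans up; move: big; clear; lia.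
  by rewrite ltn_pmul2l ?(ltnW p1) //; apply: leq_trans.
by left; exists S', E'; split=> //; rewrite cS ?leqnn // addnS ltnS leq_addr.
Qed.

Lemma turan_like_excess S E g : turan_like S E -> excess chi p S E g -> g = 0.
Proof.
move=> [f [-> _]] [_ /(_ set0 (packing0 _ _ _))]; rewrite cards0 muln0 addn0.
have [inn _] := inner_pairs_le (ltnW p1) f S; have := card_cross f S.
by move: inn; clear; lia.
Qed.

Lemma inner_pairs_bin s : inner_pairs p s <= 'C(s, 2).
Proof.
by rewrite -bin2_sum big_mkord; apply: leq_sum => i _; apply: leq_div.
Qed.

(** The descent never decreases [#|S| + 3 * g]: a step loses at most three vertices and gains one in
    excess. Once [#|S| <= large_order], the excess is at most [inner_pairs p #|S|], so this sum
    falls short of the bound. *)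
Definition order_bound := large_order.+1 + 3 * 'C(large_order.+1, 2) + 3.

(* Each peeling raises the excess, which is at most quadratic in the order. *)
Lemma no_excess S E g : proper chi E -> excess chi p S E g -> 0 < g ->
  order_bound <= #|S| + 3 * g -> False.
Proof.
have [m Sm] := ubnP #|S|; elim: m => // m IH in S E g Sm *.
move=> pE exc g0 big; have [small|large] := leqP #|S| large_order.
  have [ES /(_ set0 (packing0 _ _ _))] := exc.
  rewrite cards0 muln0 addn0 => exc0.
  have := subset_leq_card ES; rewrite card_pairs.
  have := inner_pairs_bin #|S|.
  have : 'C(#|S|, 2) <= 'C(large_order.+1, 2) by apply: leq_bin2l; apply: leqW.
  by move: exc0 small big; rewrite /order_bound; clear; lia.
have [[S' [E' [E'E lt le exc']]]|tur] := peel_or_turan pE exc large.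
  apply: (IH S' E' g.+1) => //; first exact: leq_trans lt Sm.
    exact: properS pE.
  by move: big le; clear; lia.
by rewrite (turan_like_excess tur exc) in g0.
Qed.

Lemma excess_turan S E : proper chi E -> excess chi p S E 0 ->
  order_bound <= #|S| -> turan_like S E.
Proof.
move=> pE exc big.
have large : large_order < #|S| by move: big; rewrite /order_bound; clear; lia.
have [[S' [E' [E'E lt le exc']]]|//] := peel_or_turan pE exc large.
case: (no_excess (properS E'E pE) exc' isT).
by apply: leq_trans big _; rewrite muln1.
Qed.
End Descent.

(** * The Turán graph *)

Section Balanced.
Variable p : nat.
Hypothesis p0 : 0 < p.

(** Equal fibre sizes say that the two tuples of values agree as multisets. *)
Lemma perm_of_fibres n (K : eqType) (f h : 'I_n -> K) :
  (forall k, #|[set x | f x == k]| = #|[set x | h x == k]|) ->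
  exists s : 'S_n, forall x, h (s x) = f x.
Proof.
move=> fibres.
have cnt (g : 'I_n -> K) k : count_mem k (mktuple g) = #|[set x | g x == k]|.
  rewrite /= count_map -sum1_count big_enum_cond sum1_card.
  by apply: eq_card => x; rewrite !inE.
have /tuple_permP[s eqs] : perm_eq (mktuple f) (mktuple h).
  by apply/allP=> k _; apply/eqP; rewrite [LHS]cnt [RHS]cnt fibres.
exists s => x; have := congr1 (fun t => nth (f x) t x) eqs.
by rewrite -!tnth_nth !tnth_mktuple.
Qed.

Lemma almost_equal_sizes (a : 'I_p -> nat) n : \sum_i a i = n ->
  (forall i j, a i <= (a j).+1) -> forall i, a i = n %/ p \/ a i = (n %/ p).+1.
Proof.
move=> sum_a bal.
case: (@arg_minnP _ (Ordinal p0) xpredT a isT) => i0 _ min_a.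
have lo : p * a i0 <= n.
  rewrite -sum_a -[p in p * _]card_ord -sum_nat_const.
  by apply: leq_sum => i _; apply: min_a.
have hi : n < p * (a i0).+1.
  have -> : p * (a i0).+1 = (a i0).+1 + p.-1 * (a i0).+1 by rewrite -mulSn prednK.
  rewrite -sum_a (bigD1 i0) //= -addSn leq_add2l.
  rewrite (eq_bigl [in [set~ i0]]) => [|i]; last by rewrite in_setC1.
  have -> : p.-1 = #|[set~ i0]| by rewrite cardsC1 card_ord.
  by rewrite -sum_nat_const; apply: leq_sum => i _; apply: bal.
have -> : n %/ p = a i0.
  apply/eqP; rewrite eqn_leq -ltnS ltn_divLR // [_.+1 * p]mulnC hi.
  by rewrite leq_divRL // mulnC lo.
move=> i; have := min_a i isT; have := bal i i0; clear; lia.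
Qed.

(** The sum is [p * q] plus the number of indices of value [q.+1], so it determines both
    multiplicities. *)
Lemma two_sizes (a b : 'I_p -> nat) q : \sum_i a i = \sum_i b i ->
  (forall i, a i = q \/ a i = q.+1) -> (forall i, b i = q \/ b i = q.+1) ->
  forall k, #|[set i | a i == k]| = #|[set i | b i == k]|.
Proof.
have big_count (c : 'I_p -> nat) : (forall i, c i = q \/ c i = q.+1) ->
    \sum_i c i = p * q + #|[set i | c i == q.+1]|.
  move=> cq; transitivity (\sum_i (q + (c i == q.+1))).
    apply: eq_bigr => i _.
    by case: (cq i) => ->; [rewrite ltn_eqF // addn0 | rewrite eqxx addn1].
  rewrite big_split /= sum_nat_const card_ord -sum1_card [in RHS]big_mkcond.
  by congr (_ + _); apply: eq_bigr => i _; rewrite inE; case: eqP.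
have compl (c : 'I_p -> nat) : (forall i, c i = q \/ c i = q.+1) ->
    #|[set i | c i == q]| + #|[set i | c i == q.+1]| = p.
  move=> cq; rewrite -[RHS]card_ord -(cardsC [set i | c i == q.+1]) addnC.
  congr (_ + _); apply: eq_card => i; rewrite !inE.
  by case: (cq i) => ->; rewrite eqxx ?(gtn_eqF (ltnSn q)) ?(ltn_eqF (ltnSn q)).
have zero (c : 'I_p -> nat) k : (forall i, c i = q \/ c i = q.+1) ->
    k != q -> k != q.+1 -> #|[set i | c i == k]| = 0.
  move=> cq kq kq1; apply/eqP; rewrite cards_eq0; apply/eqP/setP=> i; rewrite !inE.
  by case: (cq i) => ->; rewrite eq_sym ?(negPf kq) ?(negPf kq1).
move=> sums aq bq k; have := big_count a aq; rewrite sums (big_count b bq).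
move=> /addnI eqb; have := etrans (compl a aq) (esym (compl b bq)).
rewrite eqb => /addIn eqq.
have [->//|kq] := eqVneq k q; have [->//|kq1] := eqVneq k q.+1.
by rewrite !zero.
Qed.
End Balanced.

Lemma edges_sub_pairs (V : finType) (G : sgraph V) : edges G \subset pairs [set: V].
Proof.
apply/subsetP=> e eG; rewrite inE subsetT /=.
exact: forall_inP (edges_card2 G) e eG.
Qed.

Section TuranGraph.
Variables (p n : nat).
Hypothesis p0 : 0 < p.

Definition residue (x : 'I_n) : 'I_p := Ordinal (ltn_pmod x p0).

Lemma adj_turan_residue (x y : 'I_n) :
  adj (turan_graph p n) x y = (residue x != residue y).
Proof. by rewrite adj_turan. Qed.

Lemma part_residue_sizes i : #|part residue [set: 'I_n] i| = n %/ p \/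
  #|part residue [set: 'I_n] i| = (n %/ p).+1.
Proof.
apply: (almost_equal_sizes p0 (a := fun i => #|part residue [set: 'I_n] i|)).
  by rewrite sum_part cardsT card_ord.
move=> {}i j; have := turan_balanced n i j.
have partE k : part residue [set: 'I_n] k = [set x : 'I_n | x %% p == k].
  by apply/setP=> x; rewrite !inE.
by rewrite !partE.
Qed.

Lemma iso_turan_cross (G : sgraph 'I_n) : isomorphic G (turan_graph p n) ->
  exists f : 'I_n -> 'I_p, edges G = cross f [set: 'I_n] /\
    forall i, #|part f [set: 'I_n] i| = n %/ p \/ #|part f [set: 'I_n] i| = (n %/ p).+1.
Proof.
case=> g bij adjg; exists (residue \o g); split.
  apply/setP=> e; apply/idP/idP => eG.
    have /pairsP[u [v [_ _ uv def_e]]] := subsetP (edges_sub_pairs G) e eG.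
    rewrite def_e mem_cross !inE /= -adj_turan_residue adjg.
    by rewrite /adj -def_e.
  have /setDP[/pairsP[u [v [_ _ uv def_e]]] _] := eG.
  by move: eG; rewrite def_e mem_cross !inE /= -adj_turan_residue adjg.
move=> i; have := part_residue_sizes i.
have -> // : #|part (residue \o g) [set: 'I_n] i| = #|part residue [set: 'I_n] i|.
rewrite -(on_card_preimset (f := g) (R := part residue [set: 'I_n] i)).
  by apply: eq_card => x; rewrite !inE.
by apply: onW_bij.
Qed.

(** A permutation [s] of the parts matches their sizes with those of the residue classes; a
    permutation [g] of the vertices then carries each part onto its class. *)
Lemma cross_iso_turan (G : sgraph 'I_n) (f : 'I_n -> 'I_p) :
  edges G = cross f [set: 'I_n] ->
  (forall i, #|part f [set: 'I_n] i| = n %/ p \/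
     #|part f [set: 'I_n] i| = (n %/ p).+1) ->
  isomorphic G (turan_graph p n).
Proof.
move=> eG bal.
have sums : \sum_i #|part f [set: 'I_n] i| = \sum_i #|part residue [set: 'I_n] i|.
  by rewrite !sum_part.
have [s sE] := perm_of_fibres (two_sizes sums bal part_residue_sizes).
have [|g gE] := @perm_of_fibres n _ (s \o f) residue.
  move=> k; have := sE (s^-1 k)%g; rewrite permKV.
  have -> : [set x | residue x == k] = part residue [set: 'I_n] k.
    by apply/setP=> x; rewrite !inE.
  move=> ->; apply: eq_card => x; rewrite !inE /=.
  by apply/eqP/eqP => [<-|->]; rewrite ?permK ?permKV.
exists g; first exact/injF_bij/perm_inj.
move=> x y; rewrite adj_turan_residue !gE /= (inj_eq perm_inj).
by rewrite /adj eG mem_cross !inE.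
Qed.

End TuranGraph.

(** * From decompositions and copies to packings of vertex sets *)

Section Conversion.
Variables (V : finType) (p : nat).
Implicit Types (G : sgraph V) (Q : {set V}) (B : {set {set V}}).

Lemma edges_complete r : edges (complete_graph r) = pairs [set: 'I_r].
Proof.
apply/setP=> e; apply/imsetP/pairsP => [[[u v]]|[u [v [_ _ uv ->]]]].
  by rewrite inE andbT /= => uv ->; exists u, v; rewrite !in_setT.
by exists (u, v); rewrite // inE uv.
Qed.

Lemma imset_pairs (U : finType) (f : U -> V) : injective f ->
  [set f @: (e : {set U}) | e in pairs [set: U]] = pairs (f @: setT).
Proof.
move=> f_inj; apply/setP=> e; apply/imsetP/pairsP.
  case=> _ /pairsP[u [v [_ _ uv ->]]] ->; exists (f u), (f v).
  by rewrite !imset_f // (inj_eq f_inj) uv imsetU1 imset_set1.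
case=> _ [_ [/imsetP[u _ ->] /imsetP[v _ ->] uv ->]]; exists [set u; v].
  by rewrite mem_pairs2 !inE -(inj_eq f_inj).
by rewrite imsetU1 imset_set1.
Qed.

Lemma is_copyP r B : reflect (exists2 Q : {set V}, #|Q| = r & B = pairs Q)
  (is_copy (complete_graph r) B).
Proof.
apply: (iffP existsP) => [[f /andP[/injectiveP f_inj /eqP->]]|[Q cQ ->]].
  exists (f @: setT); first by rewrite card_imset // cardsT card_ord.
  by rewrite edges_complete imset_pairs.
pose f := [ffun i : 'I_r => enum_val (cast_ord (esym cQ) i)].
have f_inj : injective f.
  by move=> i j; rewrite !ffunE => /enum_val_inj/cast_ord_inj.
exists f; apply/andP; split; first exact/injectiveP.
rewrite edges_complete imset_pairs //; apply/eqP; congr pairs; apply/eqP.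
rewrite eq_sym eqEcard card_imset // cardsT card_ord cQ leqnn andbT.
by apply/subsetP=> _ /imsetP[i _ ->]; rewrite ffunE enum_valP.
Qed.

Lemma properP G chi : proper_coloring G chi -> proper chi (edges G).
Proof.
move=> /forall_inP pG u v w uvE uwE cc; apply/eqP/negPn/negP=> vw.
have /forall_inP/(_ _ uwE)/implyP := pG _ uvE.
rewrite cc eqxx; suff: ([set u; v] != [set u; w]) &&
    ([set u; v] :&: [set u; w] != set0) by move=> -> /(_ isT).
apply/andP; split; last by apply/set0Pn; exists u; rewrite !inE eqxx.
have uv : u != v.
  by have := forall_inP (edges_card2 G) _ uvE; rewrite cards2; case: (u != v).
apply: contra vw => /eqP/setP/(_ v); rewrite !inE eqxx orbT (eq_sym v) (negPf uv).
by move/esym.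
Qed.

(** The cliques of [P], with all remaining edges as singletons, form a decomposition in which each
    clique saves [('C(p.+1, 2)).-1] parts. *)
Lemma phi_col_packing chi G P : 1 < p -> packing chi p (edges G) P ->
  phi_col chi G (complete_graph p.+1) + ('C(p.+1, 2)).-1 * #|P| <= #|edges G|.
Proof.
move=> p1 packP; have [PQ dis] := packingP _ _ _ _ packP.
have subE := span_sub packP; have cspan := card_span packP.
pose D := [set pairs Q | Q in P] :|: [set [set e] | e in edges G :\: span P].
have C0 : 1 < 'C(p.+1, 2) by rewrite binS bin1; have : 0 < 'C(p, 2); rewrite ?bin_gt0 //; lia.
have cD : #|D| <= #|P| + #|edges G :\: span P|.
  by apply: leq_trans (leq_card_setU _ _) _; rewrite leq_add ?leq_imset_card.
suff dec : rainbow_decomposition chi G (complete_graph p.+1) D.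
  have := (phi_colP chi G (complete_graph p.+1)).2 D dec.
  have := cardsID (span P) (edges G); rewrite (setIidPr subE) cspan.
  have -> : #|P| * 'C(p.+1, 2) = #|P| + ('C(p.+1, 2)).-1 * #|P|.
    by rewrite -mulSn prednK 1?mulnC // ltnW.
  move=> <- /leq_trans/(_ cD) le.
  by rewrite addnAC leq_add2r.
apply/andP; split; last first.
  apply/forall_inP=> B /setUP[/imsetP[Q QP ->]|/imsetP[e _ ->]]; last by rewrite cards1.
  have [cQ /andP[_ rQ]] := PQ Q QP; apply/orP; right; rewrite rQ andbT.
  by apply/is_copyP; exists Q.
apply/and3P; split.
- apply/eqP/setP=> e; apply/bigcupP/idP => [[B /setUP[]]|eG].
  + case/imsetP=> Q QP -> eQ; apply: (subsetP subE); apply/spanP.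
    by exists Q.
  + by case/imsetP=> e' /setDP[e'G _] -> /set1P->.
  have [/spanP[Q QP eQ]|eP] := boolP (e \in span P).
    by exists (pairs Q) => //; apply/setUP; left; apply: imset_f.
  exists [set e]; last exact: set11.
  by apply/setUP; right; apply: imset_f; rewrite in_setD eP.
- apply/trivIsetP=> A B.
  have mixed Q e : Q \in P -> e \in edges G :\: span P -> [disjoint pairs Q & [set e]].
    move=> QP /setDP[_ eP]; rewrite disjoint_sym disjoints1.
    by apply: contra eP => eQ; apply/spanP; exists Q.
  case/setUP=> /imsetP[a aP ->] /setUP[] /imsetP[b bP ->] neq.
  + by apply: (packing_trivI packP) => //; apply: contraNneq neq => ->.
  + exact: mixed.
  + by rewrite disjoint_sym mixed.
  by rewrite disjoints1 inE; apply: contraNneq neq => ->.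
apply/setUP=> -[/imsetP[Q QP]|/imsetP[e _]] /setP.
  have [cQ _] := PQ Q QP; move=> Q0.
  suff : #|pairs Q| = 0 by rewrite card_pairs cQ; move: C0; case: 'C(_, _).
  by apply/eqP; rewrite cards_eq0; apply/eqP/setP=> e; rewrite -Q0.
by move/(_ e); rewrite !inE eqxx.
Qed.

Lemma excess_of_phi chi G : 1 < p ->
  'C(#|V|, 2) <= phi_col chi G (complete_graph p.+1) + inner_pairs p #|V| ->
  excess chi p [set: V] (edges G) 0.
Proof.
move=> p1 big; split=> [|P packP]; first exact: edges_sub_pairs.
have := phi_col_packing p1 packP; move: big; rewrite cardsT.
by move: (_ * #|P|) (phi_col _ _ _) (inner_pairs _ _); clear; lia.
Qed.

Lemma phi_col_free (U : finType) (H : sgraph U) chi G : ~~ contains H G ->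
  phi_col chi G H = #|edges G|.
Proof.
move=> /existsPn free; have [[D /andP[partD /forall_inP DB] <-] _] := phi_colP chi G H.
rewrite (card_partition partD) -sum1_card; apply: eq_bigr => B BD.
have /orP[/eqP->//|/andP[copyB _]] := DB B BD.
have := free B; rewrite copyB andbT => /negP[].
have /and3P[/eqP <- _ _] := partD; exact: bigcup_sup.
Qed.

Lemma cross_free G (f : V -> 'I_p) : edges G = cross f [set: V] ->
  ~~ contains (complete_graph p.+1) G.
Proof.
move=> eG; apply/existsPn=> B; apply/negP=> /andP[/subsetP BG /is_copyP[Q cQ defB]].
suff : #|Q| <= p by rewrite cQ ltnn.
rewrite -(card_in_imset (f := f)) => [|u v uQ vQ fuv].
  by apply: leq_trans (max_card _) _; rewrite card_ord.
apply/eqP/negPn/negP=> uv; have := BG [set u; v].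
by rewrite defB mem_pairs2 uQ vQ uv eG mem_cross fuv eqxx !andbF => /(_ isT).
Qed.
End Conversion.

(** * The extremal number and the uniqueness of the Turán graph *)

Section Turan.
Variables (p n : nat).
Hypothesis p1 : 1 < p.
Let K : sgraph 'I_p.+1 := complete_graph p.+1.

Lemma iso_turan_edges (G : sgraph 'I_n) : isomorphic G (turan_graph p n) ->
  ~~ contains K G /\ #|edges G| + inner_pairs p n = 'C(n, 2).
Proof.
case/(iso_turan_cross (ltnW p1)) => f [eG bal]; split; first exact: cross_free eG.
have := card_cross f [set: 'I_n]; rewrite eG cardsT card_ord => <-; congr (_ + _).
have [_] := inner_pairs_le (ltnW p1) f [set: 'I_n]; rewrite cardsT card_ord.
move=> eq; apply/eqP; rewrite eq; apply/forallP=> i.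
by case: (bal i) => ->; rewrite eqxx ?orbT.
Qed.

Lemma isomorphic_refl (G : sgraph 'I_n) : isomorphic G G.
Proof. by exists id => //; exists id. Qed.

Lemma turan_ex_lower : 'C(n, 2) <= ex_number n K + inner_pairs p n.
Proof.
have [free cE] := iso_turan_edges (isomorphic_refl (turan_graph p n)).
rewrite -cE leq_add2r.
exact: (leq_bigmax_cond (F := fun G : sgraph 'I_n => #|edges G|)).
Qed.

Lemma phi_iso_turan (G : sgraph 'I_n) chi : order_bound p <= n ->
  proper_coloring G chi ->
  'C(n, 2) <= phi_col chi G K + inner_pairs p n ->
  isomorphic G (turan_graph p n).
Proof.
move=> big /properP pG phi.
have exc : excess chi p [set: 'I_n] (edges G) 0.
  by apply: excess_of_phi; rewrite // card_ord.
have [|f [eG bal]] := excess_turan p1 pG exc; first by rewrite cardsT card_ord.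
by apply: (cross_iso_turan (ltnW p1)) eG _ => i; have := bal i; rewrite cardsT card_ord.
Qed.

(** Turán's theorem for large [n] follows from the rigidity: in a graph without [K_r] the
    decomposition number is the number of edges, so having more edges than the Turán graph would
    force an isomorphism with it. *)
Lemma ex_number_turan : order_bound p <= n ->
  ex_number n K + inner_pairs p n = 'C(n, 2).
Proof.
move=> big; apply/eqP; rewrite eqn_leq turan_ex_lower andbT.
have [free cE] := iso_turan_edges (isomorphic_refl (turan_graph p n)).
rewrite -cE leq_add2r; apply/bigmax_leqP=> G freeG.
have [chi pchi] := proper_coloring_exists G.
have := phi_col_free chi freeG => phiE.
have [le|lt] := leqP #|edges G| #|edges (turan_graph p n)|; first by [].
have iso : isomorphic G (turan_graph p n).
  by apply: phi_iso_turan pchi _; rewrite // phiE -cE leq_add2r ltnW.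
have [_ cG] := iso_turan_edges iso.
by move: lt; rewrite -(ltn_add2r (inner_pairs p n)) cG cE ltnn.
Qed.

End Turan.

Theorem theorem2 (r : nat) (hr : 3 <= r) :
  exists n0 : nat, forall n : nat, n0 <= n ->
    (forall G : sgraph 'I_n,
       (exists chi : {set 'I_n} -> nat,
          proper_coloring G chi /\
          ex_number n (complete_graph r) <= phi_col chi G (complete_graph r)) ->
       isomorphic G (turan_graph r.-1 n)) /\
    phiR n (complete_graph r) = ex_number n (complete_graph r) /\
    (forall G : sgraph 'I_n,
       phi_max G (complete_graph r) = phiR n (complete_graph r) <->
       isomorphic G (turan_graph r.-1 n)).
Proof.
case: r hr => // p p1; rewrite ltnS in p1; exists (order_bound p) => n big /=.
have exE := ex_number_turan p1 big.
have rigid (G : sgraph 'I_n) chi : proper_coloring G chi ->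
    ex_number n (complete_graph p.+1) <= phi_col chi G (complete_graph p.+1) ->
    isomorphic G (turan_graph p n).
  move=> pchi le; apply: (phi_iso_turan p1 big pchi).
  by rewrite -exE leq_add2r.
have maxE (G : sgraph 'I_n) : isomorphic G (turan_graph p n) ->
    phi_max G (complete_graph p.+1) = ex_number n (complete_graph p.+1).
  move=> /(iso_turan_edges p1)[free cG].
  have [[chi pchi <-] _] := phi_maxP G (complete_graph p.+1).
  by rewrite phi_col_free //; apply/eqP; rewrite -(eqn_add2r (inner_pairs p n)) cG exE.
have max_iso (G : sgraph 'I_n) :
    ex_number n (complete_graph p.+1) <= phi_max G (complete_graph p.+1) ->
    isomorphic G (turan_graph p n).
  have [[chi pchi <-] _] := phi_maxP G (complete_graph p.+1).
  exact: rigid pchi.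
have phiRE : phiR n (complete_graph p.+1) = ex_number n (complete_graph p.+1).
  apply/eqP; rewrite eqn_leq; apply/andP; split.
    apply/bigmax_leqP=> G _; rewrite leqNgt; apply/negP=> lt.
    by have := maxE G (max_iso G (ltnW lt)) => eq; rewrite eq ltnn in lt.
  rewrite -(maxE _ (isomorphic_refl (turan_graph p n))).
  exact: (leq_bigmax_cond (F := fun G : sgraph 'I_n => phi_max G (complete_graph p.+1))).
split; first by move=> G [chi [pchi le]]; apply: rigid pchi le.
split=> // G; rewrite phiRE; split=> [eq|]; last exact: maxE.
by apply: max_iso; rewrite eq.
Qed.
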